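(* Let $\sigma$ be a sigmoidal function and let $\varphi$ be a convex $\varphi$-function satisfying the $\Delta'$-condition and such that $u\mapsto u^{-\beta}\varphi(u)$, $u>0$, is increasing, for some $\beta>1$. Assume $M^\varphi_{0,1}(\phi_\sigma)<+\infty$. Then there is a constant $\Psi^{\varphi,\sigma}>0$ (independent of $f$ and $n$) such that, for every $f\in L^\varphi(I)$, $$\|K_nf-f\|_\varphi\le\Psi^{\varphi,\sigma}\cdot\omega\left(f,\frac1n\right)_\varphi$$ for every sufficiently large $n\in\mathbb N$.
   Context: Let $I=[a,b]\subset\mathbb R$ with $a<b$. Sigmoidal functions. A measurable $\sigma:\mathbb R\to\mathbb R$ is sigmoidal if $\lim_{x\to-\infty}\sigma(x)=0$ and $\lim_{x\to+\infty}\sigma(x)=1$. Here every sigmoidal function is assumed non-decreasing, with $\sigma(1)<1$, and to satisfy: (S1) $\sigma(x)-1/2$ is an odd function; (S2) $\sigma\in C^2(\mathbb R)$ is concave for $x\ge 0$; (S3) $\sigma(x)=\mathcal O(|x|^{-\alpha-1})$ as $x\to-\infty$ for some $\alpha>0$. The density function is $\phi_\sigma(x):=\frac12[\sigma(x+1)-\sigma(x-1)]$, $x\in\mathbb R$. Operators. For $f:I\to\mathbb R$ locally integrable and $n\in\mathbb N$ with $\lceil na\rceil\le\lfloor nb\rfloor-1$ (this is assumed of every $n$ considered), $$(K_nf)(x)=\frac{\sum_{k=\lceil na\rceil}^{\lfloor nb\rfloor-1}\left[n\int_{k/n}^{(k+1)/n}f(u)\,du\right]\phi_\sigma(nx-k)}{\sum_{k=\lceil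 na\rceil}^{\lfloor nb\rfloor-1}\phi_\sigma(nx-k)},\quad x\in I.$$ Orlicz spaces. A $\varphi$-function is a continuous non-decreasing $\varphi:[0,\infty)\to[0,\infty)$ with $\varphi(0)=0$, $\varphi(u)>0$ for $u>0$, $\lim_{u\to\infty}\varphi(u)=+\infty$. For measurable $f$ on $I$, $I^\varphi[f]:=\int_I\varphi(|f(x)|)\,dx$; $L^\varphi(I)$ is the set of measurable $f$ on $I$ with $I^\varphi[\lambda f]<+\infty$ for some $\lambda>0$. The Luxemburg norm is $\|f\|_\varphi:=\inf\{u>0: I^\varphi[f/u]\le1\}$. $\Delta'$-condition: there exists $C'_\varphi>0$ such that $\varphi(uv)\le C'_\varphi\,\varphi(u)\varphi(v)$ for all $u\ge0$ and $v\ge1$. Moments: for $\nu,\mu\ge0$, $M^\varphi_{\nu,\mu}(\phi_\sigma):=\sup_{u\in\mathbb R}\sum_{k\in\mathbb Z}\phi_\sigma(u-k)\,|u-k|^\nu\,\varphi(|u-k|^\mu)$; so $M^\varphi_{0,1}(\phi_\sigma)=\sup_{u\in\mathbb R}\sum_{k\in\mathbb Z}\phi_\sigma(u-k)\,\varphi(|u-k|)$. Modulus of smoothness: $\omega(f,\delta)_\varphi:=\sup_{|h|\le\delta}\|f(\cdot+h)-f(\cdot)\|_\varphi$, $\delta>0$, where $f$ is extended to $\mathbb R$ as a $(b-a)$-periodic function. *)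

(* Defs.v *)
From HB Require Import structures.
From mathcomp Require Import all_boot all_order all_algebra.
From mathcomp Require Import all_classical all_reals all_analysis.

Set Implicit Arguments.
Unset Strict Implicit.
Unset Printing Implicit Defensive.
Import Order.TTheory GRing.Theory Num.Theory.
Import numFieldNormedType.Exports.
Local Open Scope ring_scope.
Local Open Scope classical_set_scope.

(* The real line with the sigma-algebra of all Lebesgue measurable sets (the
   default sigma-algebra on R is the Borel one); the carrier is R itself. *)
Definition lebesgue_line (R : realType) : measurableType _ :=
  caratheodory_type ((@wlength R idfun)^*)%mu.

Local Notation leb := (@completed_lebesgue_measure _).

Section sigmoidal.
Context {R : realType}.

Record sigmoidal (sigma : R -> R) : Prop := Sigmoidal {
  sigmoidal_meas : measurable_fun [set: lebesgue_line R]
                     (sigma : lebesgue_line R -> R) ;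
  sigmoidal_ninfty : sigma x @[x --> -oo] --> (0 : R) ;
  sigmoidal_pinfty : sigma x @[x --> +oo] --> (1 : R) ;
  sigmoidal_ndecr : {homo sigma : x y / x <= y} ;
  sigmoidal_lt1 : sigma 1 < 1 ;
  sigmoidal_odd : forall x, sigma (- x) - 2^-1 = - (sigma x - 2^-1) ;
  sigmoidal_derivable1 : forall x, derivable sigma x 1 ;
  sigmoidal_derivable2 : forall x, derivable sigma^`() x 1 ;
  sigmoidal_C2 : continuous sigma^`(2) ;
  sigmoidal_concave : convex_function (`[0, +oo[%classic : set R)
                        (fun x => - sigma x) ;
  sigmoidal_decay : exists2 alpha : R, 0 < alpha &
    (sigma : R -> R^o) =O_ (FilterType (ninfty_nbhs R) _) (fun x => `|x| `^ (- alpha - 1) : R^o) }.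

Definition density (sigma : R -> R) (x : R) : R :=
  2^-1 * (sigma (x + 1) - sigma (x - 1)).

End sigmoidal.

Section kantorovich.
Context {R : realType}.
Variables (a b : R) (sigma : R -> R).

Definition admissible (n : nat) : bool :=
  Num.ceil (n%:R * a) <= Num.floor (n%:R * b) - 1.

Definition nodes (n : nat) : set int :=
  [set k | Num.ceil (n%:R * a) <= k <= Num.floor (n%:R * b) - 1].

Definition mean (n : nat) (f : R -> R) (k : int) : R :=
  n%:R * Rintegral leb
           (`[k%:~R / n%:R, (k + 1)%:~R / n%:R] : set (lebesgue_line R)) f.

Definition kantorovich (n : nat) (f : R -> R) (x : R) : R :=
  (\sum_(k \in nodes n) mean n f k * density sigma (n%:R * x - k%:~R)) /
  (\sum_(k \in nodes n) density sigma (n%:R * x - k%:~R)).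

End kantorovich.

Section phi_function.
Context {R : realType}.
Implicit Type phi : R -> R.

(* A function on [0, +oo[ is represented by a function on R whose values at
   negative arguments are irrelevant. *)
Record phi_function phi : Prop := PhiFunction {
  phi_continuous : {within `[0, +oo[, continuous phi} ;
  phi_ndecr : {in `[0, +oo[ &, {homo phi : u v / u <= v}} ;
  phi_0 : phi 0 = 0 ;
  phi_gt0 : forall u, 0 < u -> 0 < phi u ;
  phi_pinfty : phi u @[u --> +oo] --> +oo }.

Definition convex_phi phi : Prop :=
  convex_function (`[0, +oo[%classic : set R) phi.

Definition Delta'_condition phi : Prop :=
  exists2 C : R, 0 < C &
    forall u v, 0 <= u -> 1 <= v -> phi (u * v) <= C * phi u * phi v.

Definition moment phi (nu mu : R) (chi : R -> R) : \bar R :=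
  ereal_sup (range (fun u : R => \esum_(k in [set: int])
    (chi (u - k%:~R) * `|u - k%:~R| `^ nu * phi (`|u - k%:~R| `^ mu))%:E)).

End phi_function.

Section orlicz.
Context {R : realType}.
Variables (a b : R) (phi : R -> R).
Implicit Type f : R -> R.
Local Open Scope ereal_scope.

(* Functions on [a, b] are represented by functions on R, of which only the
   values on [a, b] are used. *)
Definition modular f : \bar R :=
  \int[leb]_(x in (`[a, b] : set (lebesgue_line R))) (phi `|f x|%R)%:E.

Definition orlicz f : Prop :=
  measurable_fun (`[a, b] : set (lebesgue_line R))
    (f : lebesgue_line R -> R) /\
  exists2 l : R, (0 < l)%R & modular (fun x => l * f x)%R < +oo.

Definition luxemburg f : \bar R :=
  ereal_inf [set u%:E | u in
    [set u : R | (0 < u)%R /\ modular (fun x => f x / u)%R <= 1]].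

(* The (b - a)-periodic function that agrees with f on [a, b[. *)
Definition periodization f (x : R) : R :=
  f (x - (Num.floor ((x - a) / (b - a)))%:~R * (b - a))%R.

Definition modulus f (delta : R) : \bar R :=
  ereal_sup [set luxemburg
      (fun x => periodization f (x + h) - periodization f x)%R
    | h in [set h : R | (`|h| <= delta)%R]].

End orlicz.

(* Main.v *)
Require Import Defs.
From mathcomp Require Import all_boot all_order all_algebra.
From mathcomp Require Import all_classical all_reals all_analysis.
From mathcomp Require Import measurable_realfun.
From mathcomp Require Import ring lra zify.
Set Implicit Arguments.
Unset Strict Implicit.
Unset Printing Implicit Defensive.
Import Order.TTheory GRing.Theory Num.Theory.
Import numFieldNormedType.Exports.
Local Open Scope classical_set_scope.
Local Open Scope ring_scope.

(** Averaging a function over cells of length 1/n changes it by at most an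
average of its own increments, and the proof consists in comparing long
increments with short ones.

By Jensen's inequality, at each point x of [a, b] the value of phi at
|K_n f (x) - f (x)| is at most the sum over the nodes k of
  w_k (x) n (integral over u in the k-th cell of phi |f u - f x|),
with w_k (x) = density (n x - k) / (sum over j of density (n x - j)).  The
denominator is bounded below by a positive constant depending on sigma only
([density_sum_lower_bound]): some node k satisfies -1 <= n x - k <= 2, and
concavity together with sigma 1 < 1 makes the density positive there.

For u = x + h in the k-th cell, n x - k differs from - n h by a number of
[0, 1].  As sigma is monotone, density (n x - k) is at most a weight
[bandwidth] m that depends only on m, the absolute value of the integer part
of n h ([density_le_bandwidth]).  Substituting u = x + h and applying Tonelli's
theorem, the modular of K_n f - f is at most a constant times
  n (integral over h of bandwidth m times the modular of f (. + h) - f).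

A shift h with n |h| <= m + 1 is a composition of m + 1 shifts of length at most
1/n.  Convexity, the Delta' condition, and the invariance under translation of
the integral of a periodic function over a period bound the modular of
f (. + h) - f by C phi (m + 1) times a common bound for the modulars of short
increments ([long_shift]).  Each value of m is taken on a set of h of measure at
most 2/n, so the factor n cancels, and there remains the series of the terms
bandwidth m * phi (m + 1).  It converges by the moment hypothesis
([bandwidth_summable]).

This gives a bound between modulars ([borel_estimate]).  Applied to f / u with u
above the modulus of smoothness it bounds the modular of (K_n f - f) / u by a
constant D, and convexity turns this into a bound of the Luxemburg norm by
max 1 D times u.

Tonelli's theorem needs the joint measurability of (x, h) |-> f (x + h) - f x,
which is immediate for Borel f but not for Lebesgue measurable f.  Hence f is
first replaced by the
periodization of a Borel function that agrees with it almost everywhere on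
[a, b] ([borel_representative], [fold_null_translate]). *)

(** * Convex phi-functions *)

Section phi_function_theory.
Context {R : realType}.
Variable phi : R -> R.
Hypotheses (phiP : phi_function phi) (phi_cvx : convex_phi phi).

Lemma phi_ge0 u : 0 <= u -> 0 <= phi u.
Proof.
rewrite le_eqVlt => /predU1P[<-|u0]; first by rewrite (phi_0 phiP).
exact/ltW/(phi_gt0 phiP).
Qed.

Lemma phi_le u v : 0 <= u -> u <= v -> phi u <= phi v.
Proof.
move=> u0 uv; apply: (phi_ndecr phiP) => //; rewrite ?inE/= in_itv/= andbT //.
exact: le_trans uv.
Qed.

Lemma convex_phiE (t x y : R) : 0 <= t <= 1 -> 0 <= x -> 0 <= y ->
  phi (t * x + (1 - t) * y) <= t * phi x + (1 - t) * phi y.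
Proof.
move=> /andP[t0 t1] x0 y0.
have := @phi_cvx (Itv01 t0 t1) (x : R^o) (y : R^o).
rewrite !inE/= !in_itv/= !andbT => /(_ x0 y0).
by [].
Qed.

(** The slope is the supremum of the slopes of the chords ending at m on the
    right; convexity bounds them by the slope of any chord starting at m.  For
    m = 0 monotonicity allows the slope 0. *)
Lemma supporting_line m : 0 <= m ->
  exists2 s, 0 <= s & forall v, 0 <= v -> phi m + s * (v - m) <= phi v.
Proof.
rewrite le_eqVlt => /predU1P[<-|m0].
  exists 0 => // v v0; rewrite mul0r addr0; exact: phi_le.
have slope_le y z : 0 <= y -> y < m -> m < z ->
    (phi m - phi y) / (m - y) <= (phi z - phi m) / (z - m).
  move=> y0 ym mz.
  have zy : 0 < z - y by rewrite subr_gt0 (lt_trans ym).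
  have t01 : 0 <= (m - y) / (z - y) <= 1.
    apply/andP; split; first by rewrite divr_ge0 ?subr_ge0 ?(ltW ym)// -subr_ge0 ltW.
    by rewrite ler_pdivrMr// mul1r lerD2r ltW.
  have := convex_phiE t01 (le_trans y0 (ltW (lt_trans ym mz))) y0.
  have -> : (m - y) / (z - y) * z + (1 - (m - y) / (z - y)) * y = m.
    by field; rewrite gt_eqF.
  move=> H; rewrite ler_pdivrMr ?subr_gt0// mulrAC ler_pdivlMr ?subr_gt0//.
  have : phi m * (z - y) <= (m - y) * phi z + (z - m) * phi y.
    rewrite -ler_pdivlMr// (le_trans H)// le_eqVlt; apply/orP; left; apply/eqP.
    by field; rewrite gt_eqF.
  by lra.
pose S := [set (phi m - phi y) / (m - y) | y in `[0, m[%classic].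
have S0 : S ((phi m - phi 0) / (m - 0)) by exists 0 => //=; rewrite in_itv/= lexx m0.
have ubS z : m < z -> ubound S ((phi z - phi m) / (z - m)).
  by move=> mz r [y /=]; rewrite in_itv/= => /andP[y0 ym] <-; exact: slope_le.
have hS : has_sup S.
  by split; [exists ((phi m - phi 0) / (m - 0))|
     exists ((phi (m + 1) - phi m) / (m + 1 - m)); apply: ubS; rewrite ltrDl].
exists (sup S).
  apply: (@le_trans _ _ ((phi m - phi 0) / (m - 0))).
    by rewrite (phi_0 phiP) !subr0 divr_ge0 ?ltW ?(phi_gt0 phiP).
  exact: (sup_upper_bound hS).
move=> v v0; have [vm|mv|->] := ltgtP v m; last by rewrite subrr mulr0 addr0.
- have : (phi m - phi v) / (m - v) <= sup S.
    by apply: (sup_upper_bound hS); exists v => //=; rewrite in_itv/= v0 vm.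
  by rewrite ler_pdivrMr ?subr_gt0//; lra.
- have : sup S <= (phi v - phi m) / (v - m).
    by apply: ge_sup; [exact: hS.1|exact: ubS].
  by rewrite ler_pdivlMr ?subr_gt0//; lra.
Qed.

(** Compare the supporting line at v / c with phi at 0 and at v. *)
Lemma phi_contract (c v : R) : 1 <= c -> 0 <= v -> c * phi (v / c) <= phi v.
Proof.
move=> c1 v0; have c0 : 0 < c by exact: lt_le_trans c1.
have [w w0 ->] : exists2 w, 0 <= w & v = c * w.
  by exists (v / c); [rewrite divr_ge0 // ltW|field; rewrite gt_eqF].
have -> : c * w / c = w by field; rewrite gt_eqF.
have [s s0 sP] := supporting_line w0.
have Hv := sP (c * w) (mulr_ge0 (ltW c0) w0).
have := sP 0 (lexx _); rewrite (phi_0 phiP) => H0.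
apply: le_trans Hv; suff : 0 <= (c - 1) * (s * w - phi w) by lra.
by rewrite mulr_ge0 ?subr_ge0//; lra.
Qed.

(** Jensen's inequality for m equal weights: add up the values at the points
    m v_j of the supporting line at the sum of the v_j, which is their mean. *)
Lemma phi_sum (m : nat) (v : nat -> R) : (0 < m)%N -> (forall j, 0 <= v j) ->
  phi (\sum_(j < m) v j) <= m%:R^-1 * \sum_(j < m) phi (v j * m%:R).
Proof.
move=> m0 v0; set p := \sum_(j < m) v j.
have p0 : 0 <= p by exact: sumr_ge0.
have [s s0 sP] := supporting_line p0.
have mp : 0 < m%:R :> R by rewrite ltr0n.
rewrite mulrC ler_pdivlMr//.
have -> : phi p * m%:R = \sum_(j < m) (phi p + s * (v j * m%:R - p)).
  rewrite big_split/= sumr_const card_ord -mulr_sumr sumrB -mulr_suml -/p.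
  by rewrite sumr_const card_ord (mulr_natr p) subrr mulr0 addr0 mulr_natr.
by apply: ler_sum => j _; apply: sP; rewrite mulr_ge0.
Qed.

Lemma measurable_phi_norm : measurable_fun setT (fun v : R => phi `|v|).
Proof.
have mphi : measurable_fun (`[0, +oo[%classic : set R) phi.
  apply: subspace_continuous_measurable_fun; first exact: measurable_itv.
  exact: (phi_continuous phiP).
apply: (@measurable_comp _ _ _ _ _ _ (`[0, +oo[%classic : set R)
  phi setT (@Num.norm R R)) => //.
by move=> _ [x _ <-] /=; rewrite in_itv/= normr_ge0.
Qed.

End phi_function_theory.

(** * The density of a sigmoidal function *)

Section density_theory.
Context {R : realType}.
Variable sigma : R -> R.
Hypothesis sigmaP : sigmoidal sigma.

Lemma sigmoidal_le x y : x <= y -> sigma x <= sigma y.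
Proof. by move=> xy; apply: (sigmoidal_ndecr sigmaP). Qed.

Lemma density_ge0 x : 0 <= density sigma x.
Proof. by rewrite mulr_ge0// subr_ge0 sigmoidal_le//; lra. Qed.

Lemma densityN x : density sigma (- x) = density sigma x.
Proof.
have := sigmoidal_odd sigmaP (x + 1); have := sigmoidal_odd sigmaP (x - 1).
rewrite /density; have -> : - x + 1 = - (x - 1) by ring.
have -> : - x - 1 = - (x + 1) by ring.
by lra.
Qed.

Lemma measurable_density : measurable_fun setT (density sigma).
Proof.
have msigma : measurable_fun setT sigma.
  apply: continuous_measurable_fun => x.
  by apply/differentiable_continuous/derivable1_diffP; exact: (sigmoidal_derivable1 sigmaP).
apply: measurable_funM => //; apply: measurable_funB; apply: measurableT_comp => //.
- exact: measurable_funD.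
- exact: measurable_funB.
Qed.

(** The smaller of the two lower bounds for the density on [-1, 1] and on
    [1, 2] that monotonicity of sigma gives; which one it is follows from
    concavity. *)
Definition density_gap : R := 2^-1 * (sigma 2 - sigma 1).

Lemma sigma_concave (t x y : R) : 0 <= t <= 1 -> 0 <= x -> 0 <= y ->
  t * sigma x + (1 - t) * sigma y <= sigma (t * x + (1 - t) * y).
Proof.
move=> /andP[t0 t1] x0 y0.
have cvx := sigmoidal_concave sigmaP.
have := @cvx (Itv01 t0 t1) (x : R^o) (y : R^o).
rewrite !inE/= !in_itv/= !andbT => /(_ x0 y0).
rewrite !convRE/= => H.
rewrite -lerN2 opprD -!mulrN; exact: H.
Qed.

(** If sigma took the same value at 1 and at 2, concavity would keep it below
    sigma 1 < 1 on the whole half-line, against its limit 1. *)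
Lemma density_gap_gt0 : 0 < density_gap.
Proof.
rewrite mulr_gt0// subr_gt0 lt_neqAle sigmoidal_le ?ler1n// andbT.
apply/eqP => s12.
suff le1 x : 2 <= x -> sigma x <= sigma 1.
  have := sigmoidal_lt1 sigmaP; apply/negP; rewrite -leNgt.
  have := sigmoidal_pinfty sigmaP.
  apply: (@closed_cvg _ _ _ _ sigma (fun y => y <= sigma 1)); first exact: closed_le.
  by exists 2; split => // x /ltW; exact: le1.
(* 2 is the convex combination of x and 1 with weight 1 / (x - 1) on x. *)
move=> x2; have x10 : 0 < x - 1 by lra.
have t0 : 0 < (x - 1)^-1 by rewrite invr_gt0.
have t1 : (x - 1)^-1 <= 1 by rewrite invf_le1//; lra.
have := @sigma_concave (x - 1)^-1 x 1.
have -> : (x - 1)^-1 * x + (1 - (x - 1)^-1) * 1 = 2 :> R by field; rewrite gt_eqF.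
have x0 : 0 <= x by lra.
rewrite (ltW t0) t1 -s12 => /(_ isT x0 ler01) H.
by rewrite -(ler_pM2l t0); lra.
Qed.

Lemma density_lower_bound y : -1 <= y <= 2 -> density_gap <= density sigma y.
Proof.
have s021 : sigma 0 + sigma 2 <= 2 * sigma 1.
  have := @sigma_concave 2^-1 0 2.
  have -> : 2^-1 * 0 + (1 - 2^-1) * 2 = 1 :> R by field.
  have half : 0 <= (2^-1 : R) <= 1 by apply/andP; split; lra.
  by move=> /(_ half (lexx _) (ler0n _ _)); lra.
have s0 : sigma (- 1) = 2 * sigma 0 - sigma 1.
  have := sigmoidal_odd sigmaP 1; have := sigmoidal_odd sigmaP 0.
  by rewrite oppr0; lra.
move=> /andP[y1 y2]; rewrite ler_wpM2l//.
have [y1'|y1'] := leP 1 y.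
  by rewrite lerB// sigmoidal_le//; lra.
have [y0|y0] := leP 0 y.
  by have := @sigmoidal_le 1 (y + 1); have := @sigmoidal_le (y - 1) 0; lra.
by have := @sigmoidal_le 0 (y + 1); have := @sigmoidal_le (y - 1) (- 1); lra.
Qed.

(** Twice this weight is the increment of sigma over the interval of length 4
    centred at m (or, by symmetry, at - m), which contains every interval of
    length 2 centred within distance 1 of m. *)
Definition bandwidth (m : nat) : R :=
  density sigma (m%:R - 1) + density sigma (m%:R + 1).

Lemma bandwidth_ge0 m : 0 <= bandwidth m.
Proof. by rewrite addr_ge0// density_ge0. Qed.

(** With q the integer part of s, the point t - s lies in [-1 - q, 1 - q], and the
    two densities at the ends of this interval add up to half the increment of
    sigma over [-2 - q, 2 - q]. *)
Lemma density_le_bandwidth t s : 0 <= t <= 1 ->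
  density sigma (t - s) <= bandwidth `|Num.floor s|%N.
Proof.
move=> /andP[t0 t1]; set q := Num.floor s.
have /andP[qs sq] : q%:~R <= s < (q + 1)%:~R by rewrite /q floor_itv.
rewrite intrD in sq.
have -> : bandwidth `|q|%N = density sigma (1 - q%:~R) + density sigma (- 1 - q%:~R).
  have [q0|q0] := leP 0 q.
    have -> : q%:~R = `|q|%N%:R :> R by rewrite -{1}(gez0_abs q0).
    rewrite /bandwidth -(densityN (_ - 1)) -(densityN (_ + 1)).
    by congr (density _ _ + density _ _); ring.
  have -> : q%:~R = - (`|q|%N%:R) :> R.
    by rewrite -[LHS]opprK -intrN -(ltz0_abs q0).
  rewrite /bandwidth addrC.
  by congr (density _ _ + density _ _); ring.
have := @sigmoidal_le (t - s + 1) (2 - q%:~R).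
have := @sigmoidal_le (- 2 - q%:~R) (t - s - 1).
rewrite /density.
have -> : 1 - q%:~R + 1 = 2 - q%:~R :> R by ring.
have -> : 1 - q%:~R - 1 = - q%:~R :> R by ring.
have -> : - 1 - q%:~R + 1 = - q%:~R :> R by ring.
have -> : - 1 - q%:~R - 1 = - 2 - q%:~R :> R by ring.
by lra.
Qed.

(** The moment at u = 0 is the sum over the integers of
    e k = density k * phi |k|.  The Delta' condition bounds phi (m + 1) by a
    multiple of phi |m - 1|, since m + 1 <= 3 (m - 1) for m >= 2, and
    m + 1 = |m - 1| for m = 0; only m = 1, where phi |m - 1| vanishes, has to
    be set apart.  The other terms are at most a multiple of
    e (m - 1) + e (m + 1). *)
Lemma bandwidth_summable (phi : R -> R) : phi_function phi ->
  Delta'_condition phi -> (moment phi 0 1 (density sigma) < +oo)%E ->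
  (\sum_(0 <= m <oo) (bandwidth m * phi m.+1%:R)%:E < +oo)%E.
Proof.
move=> phiP [C C0 phiC] moo.
pose e (k : int) : \bar R := (density sigma k%:~R * phi `|k%:~R|)%:E.
have e0 k : (0 <= e k)%E.
  by rewrite lee_fin mulr_ge0 ?density_ge0// (phi_ge0 phiP).
have eoo : (\esum_(k in [set: int]) e k < +oo)%E.
  apply: le_lt_trans moo; apply: ereal_sup_ubound; exists 0 => //.
  apply: eq_esum => k _; rewrite sub0r densityN normrN powRr0 mulr1.
  by rewrite powRr1.
have sub_e (P : pred nat) (g : nat -> int) : injective g ->
    (\sum_(m <oo | P m) e (g m) < +oo)%E.
  move=> g_inj; rewrite -esum_pred_image//; last by move=> ? ? _ _; exact: g_inj.
  apply: le_lt_trans eoo; apply: ereal_sup_le => _ [X [finX _] <-].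
  by exists X.
have phi3 : 0 < phi 3 by apply: (phi_gt0 phiP).
pose c := 1 + C * phi 3.
have c1 : 1 <= c by rewrite lerDl mulr_ge0// ltW.
have c0 : 0 <= c by lra.
rewrite (@nneseriesD1 _ _ 1%N)//; last first.
  by move=> k _; rewrite lee_fin mulr_ge0 ?bandwidth_ge0 ?(phi_ge0 phiP).
rewrite lte_add_pinfty ?ltry//.
apply: (@le_lt_trans _ _ (\sum_(0 <= m <oo | m != 1%N)
    (c%:E * e (m%:Z - 1)%R + c%:E * e (m%:Z + 1)%R))%E).
  apply: lee_nneseries => [m _ _|m m1].
    by rewrite lee_fin mulr_ge0 ?bandwidth_ge0 ?(phi_ge0 phiP).
  rewrite -!EFinM -EFinD lee_fin /bandwidth mulrDl.
  have mB : (m%:Z - 1)%:~R = m%:R - 1 :> R by rewrite intrB.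
  have mD : (m%:Z + 1)%:~R = m%:R + 1 :> R by rewrite intrD.
  rewrite mB mD; apply: lerD; rewrite mulrCA ler_wpM2l ?density_ge0//.
    case: m m1 {mB mD} => [_|[//|m _]].
      rewrite sub0r normrN normr1 -[leLHS]mul1r ler_wpM2r// (phi_ge0 phiP)//.
    have -> : m.+2%:R - 1 = m.+1%:R :> R by rewrite -[m.+2]addn1 natrD addrK.
    rewrite ger0_norm//.
    apply: (@le_trans _ _ (phi (m.+1%:R * 3))).
      by apply: (phi_le phiP) => //; rewrite -natrM ler_nat; lia.
    apply: (le_trans (phiC _ _ _ _)) => //; first by rewrite ler1n.
    rewrite mulrAC ler_wpM2r ?(phi_ge0 phiP)//.
    by rewrite /c; lra.
  rewrite natr1 ger0_norm// -[leLHS]mul1r ler_wpM2r// (phi_ge0 phiP)//.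
rewrite nneseriesD; last 2 first.
- by move=> *; rewrite mule_ge0.
- by move=> *; rewrite mule_ge0.
rewrite !nneseriesZl//.
by rewrite lte_add_pinfty// lte_mul_pinfty ?lee_fin// sub_e// => x y; lia.
Qed.

End density_theory.

(** * Translations and periodic functions *)

Section translation.
Context {R : realType}.
Local Open Scope ereal_scope.
Local Notation mu := (@lebesgue_measure R).

Lemma addr_preimage_itv (c : R) (b0 b1 : bool) (x y : R) :
  (fun z : R => z + c)%R @^-1` [set` Interval (BSide b0 x) (BSide b1 y)] =
  [set` Interval (BSide b0 (x - c)%R) (BSide b1 (y - c)%R)].
Proof.
apply/seteqP; split => z /=; rewrite !in_itv/=;
by case: b0; case: b1 => /=; rewrite ?lerBlDr ?ltrBlDr ?lerBrDr ?ltrBrDr.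
Qed.

Lemma lebesgue_measure_translate (c : R) (A : set R) : measurable A ->
  pushforward mu ((fun z : R => z + c)%R : measurableTypeR R -> measurableTypeR R) A = mu A.
Proof.
move=> mA.
have mc : @measurable_fun _ _ (measurableTypeR R) (measurableTypeR R) setT
    (fun z : R => z + c)%R by exact: measurable_funD.
apply/esym/lebesgue_measure_unique => //= _ [[a b]] _ <-.
rewrite /pushforward/= addr_preimage_itv !lebesgue_measure_itv/=.
by rewrite !lte_fin ltrD2r -!EFinB; case: ifPn => // _; congr EFin; ring.
Qed.

Lemma ge0_integral_translate (c : R) (D : set R) (f : R -> \bar R) :
  measurable D -> measurable_fun setT f -> (forall x, 0 <= f x) ->
  \int[mu]_(x in (fun z => z + c)%R @^-1` D) f (x + c)%R = \int[mu]_(x in D) f x.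
Proof.
move=> mD mf f0.
have mc : @measurable_fun _ _ (measurableTypeR R) (measurableTypeR R) setT
    (fun z : R => z + c)%R by exact: measurable_funD.
rewrite -(@ge0_integral_pushforward _ _ _ _ _ _ mc)//; last exact: measurable_funTS.
by apply: eq_measure_integral => A mA _; exact: (lebesgue_measure_translate c mA).
Qed.

Variables (a T : R) (P : R -> \bar R).
Hypotheses (T0 : (0 < T)%R) (mP : measurable_fun setT P) (P0 : forall x, 0 <= P x).
Hypothesis P_per : forall (k : int) x, P (x + k%:~R * T)%R = P x.

(** By periodicity c can be taken in [0, T[; then the part of
    [a + c, a + T + c[ beyond a + T is moved back by T onto [a, a + c[. *)
Lemma ge0_integral_periodic_translate (c : R) :
  \int[mu]_(x in `[a, (a + T)%R]) P (x + c)%R = \int[mu]_(x in `[a, (a + T)%R]) P x.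
Proof.
wlog : c / (0 <= c < T)%R.
  move=> H; pose k := Num.floor (c / T).
  transitivity (\int[mu]_(x in `[a, (a + T)%R]) P (x + (c - k%:~R * T))%R).
    apply: eq_integral => x _; rewrite -[in LHS](subrK (k%:~R * T) c)%R addrA.
    by rewrite P_per.
  apply: H; have /andP[] : (k%:~R <= c / T < (k + 1)%:~R)%R by rewrite /k floor_itv.
  rewrite ler_pdivlMr// ltr_pdivrMr// intrD mulrDl mul1r => H1 H2.
  by rewrite subr_ge0 H1 ltrBlDl.
move=> /andP[c0 cT].
have mPc : measurable_fun setT (fun x : R => P (x + c)%R).
  by apply: measurableT_comp => //; exact: measurable_funD.
have acT : (a <= a + c)%R by rewrite lerDl.
have cTT : (a + c <= a + T)%R by rewrite lerD2l ltW.
have split_at (x y z : R) : (x <= y)%R -> (y <= z)%R ->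
  \int[mu]_(t in `[x, z[) P t = \int[mu]_(t in `[x, y[) P t + \int[mu]_(t in `[y, z[) P t.
  move=> xy yz.
  rewrite -ge0_integral_setU//; last 2 first.
  - exact: measurable_funTS.
  - apply/disj_setPS => t [] /=; rewrite !in_itv/= => /andP[_ ty] /andP[yt _].
    by move: (lt_le_trans ty yt); rewrite ltxx.
  congr (integral _ _ _); apply/seteqP; split => t /=; rewrite !in_itv/=.
    by move=> /andP[xt tz]; have [ty|yt] := ltP t y; [left|right]; apply/andP.
  by move=> [] /andP[h1 h2]; rewrite ?h1 ?h2 ?(lt_le_trans h2)// (le_trans xy).
transitivity (\int[mu]_(t in `[(a + c)%R, (a + T + c)%R[) P t).
  rewrite -[RHS](ge0_integral_translate c)// addr_preimage_itv !addrK.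
  by rewrite integral_itv_bndo_bndc//; exact: measurable_funTS.
rewrite (@split_at _ (a + T)%R)//; last by rewrite lerDl.
transitivity (\int[mu]_(t in `[(a + c)%R, (a + T)%R[) P t +
    \int[mu]_(t in `[a, (a + c)%R[) P t).
  congr (_ + _); rewrite -[LHS](ge0_integral_translate T)// addr_preimage_itv.
  rewrite addrK addrAC addrK.
  by apply: eq_integral => t _; have := P_per 1 t; rewrite mul1r.
rewrite addeC -split_at// integral_itv_bndo_bndc//; exact: measurable_funTS.
Qed.

End translation.

(** * Cells and integer parts *)

Section floor_cells.
Context {R : realType}.
Local Notation mu := (@lebesgue_measure R).

Definition cell (n : nat) (k : int) : set R := `[k%:~R / n%:R, (k + 1)%:~R / n%:R].

Lemma floor_level (n : nat) (k : int) : (0 < n)%N ->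
  [set h : R | Num.floor (n%:R * h) = k] = `[k%:~R / n%:R, (k + 1)%:~R / n%:R[%classic.
Proof.
move=> n0; have n0' : 0 < n%:R :> R by rewrite ltr0n.
apply/seteqP; split => h /=; rewrite in_itv/= ler_pdivrMr// ltr_pdivlMr// (mulrC h).
  by move=> <-; exact: floor_itv.
exact: floor_def.
Qed.

Lemma lebesgue_measure_floor_level (n : nat) (k : int) : (0 < n)%N ->
  mu [set h | Num.floor (n%:R * h) = k] = (n%:R^-1)%:E.
Proof.
move=> n0; have n0' : 0 < n%:R :> R by rewrite ltr0n.
rewrite floor_level// lebesgue_measure_itv/= lte_fin ltr_pM2r ?invr_gt0//.
rewrite ltr_int ltrDl/= -EFinB intrD; congr EFin; ring.
Qed.

Lemma lebesgue_measure_cell (n : nat) (k : int) : (0 < n)%N ->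
  mu (cell n k) = (n%:R^-1)%:E.
Proof.
move=> n0; have n0' : 0 < n%:R :> R by rewrite ltr0n.
rewrite /cell lebesgue_measure_itv/= lte_fin ltr_pM2r ?invr_gt0//.
rewrite ltr_int ltrDl/= -EFinB intrD; congr EFin; ring.
Qed.

Lemma absz_floor_levelE (n m : nat) : [set h : R | `|Num.floor (n%:R * h)|%N = m] =
  [set h | Num.floor (n%:R * h) = m%:Z] `|` [set h | Num.floor (n%:R * h) = - m%:Z].
Proof.
apply/seteqP; split => h /=; move: (Num.floor _) => k; last by case=> ->; rewrite ?abszN.
by move=> <-; case: (leP 0 k) => k0; [left; rewrite gez0_abs|right; rewrite ltz0_abs// opprK].
Qed.

Lemma measurable_absz_floor_level (n m : nat) : (0 < n)%N ->
  measurable [set h : R | `|Num.floor (n%:R * h)|%N = m].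
Proof.
move=> n0; rewrite absz_floor_levelE !floor_level//.
by apply: measurableU; exact: measurable_itv.
Qed.

Lemma measurable_absz_floor (n : nat) (H : nat -> R) : (0 < n)%N ->
  measurable_fun setT (fun h : R => H `|Num.floor (n%:R * h)|%N).
Proof.
move=> n0 _ Y mY; rewrite setTI.
have -> : (fun h : R => H `|Num.floor (n%:R * h)|%N) @^-1` Y =
    \bigcup_(m in [set m | Y (H m)]) [set h | `|Num.floor (n%:R * h)|%N = m].
  apply/seteqP; split => [h /= Yh|h [m /= Ym hm]]; last by rewrite /= hm.
  by exists `|Num.floor (n%:R * h)|%N.
by apply: bigcup_measurable => m _; exact: measurable_absz_floor_level.
Qed.

(** The integer part of n h has absolute value m on at most two intervals of
    length 1/n. *)
Lemma integral_absz_floor_le (n : nat) (H : nat -> R) : (0 < n)%N ->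
  (forall m, 0 <= H m) ->
  (\int[mu]_h (H `|Num.floor (n%:R * h)|%N)%:E
    <= (2 / n%:R)%:E * \sum_(0 <= m <oo) (H m)%:E)%E.
Proof.
move=> n0 H0; pose F m := [set h : R | `|Num.floor (n%:R * h)|%N = m].
have -> : [set: R] = \bigcup_m F m.
  by apply/seteqP; split => // h _; exists `|Num.floor (n%:R * h)|%N.
rewrite ge0_integral_bigcup//; last 4 first.
- by move=> m; exact: measurable_absz_floor_level.
- by apply/measurable_EFinP; apply: measurable_funTS; exact: measurable_absz_floor.
- by move=> h _; rewrite lee_fin.
- apply/trivIsetP => i j _ _ ij; apply/seteqP; split => // h [/= hi hj].
  by rewrite -hi -hj eqxx in ij.
rewrite -nneseriesZl//; last by move=> m _; rewrite lee_fin.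
apply: lee_nneseries => [m _ _|m _].
  by apply: integral_ge0 => h _; rewrite lee_fin.
rewrite (eq_integral (cst (H m)%:E)); last by move=> h; rewrite inE /F/= => ->.
rewrite integral_cst; last exact: measurable_absz_floor_level.
rewrite muleC lee_wpmul2r ?lee_fin// /F absz_floor_levelE.
apply: (le_trans (measureU2 _ _ _)).
- by rewrite floor_level//; exact: measurable_itv.
- by rewrite floor_level//; exact: measurable_itv.
apply: (@le_trans _ _ ((n%:R^-1)%:E + (n%:R^-1)%:E)%E).
  by apply: leeD; rewrite le_eqVlt; apply/orP; left; apply/eqP;
    exact: lebesgue_measure_floor_level.
rewrite -EFinD lee_fin.
by rewrite le_eqVlt; apply/orP; left; apply/eqP; ring.
Qed.

End floor_cells.

(** * Jensen's inequality for weighted means *)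

Section jensen.
Context {R : realType}.
Local Notation mu := (@lebesgue_measure R).
Variable phi : R -> R.
Hypotheses (phiP : phi_function phi) (phi_cvx : convex_phi phi).

Lemma measurable_phi_normB (G : R -> R) (y : R) : measurable_fun setT G ->
  measurable_fun setT (fun u => phi `|G u - y|).
Proof.
move=> mG; apply: (measurableT_comp (measurable_phi_norm phiP)).
exact: measurable_funB.
Qed.

Lemma integrable_cst_lty (A : set R) (c : R) : measurable A -> (mu A < +oo)%E ->
  mu.-integrable A (EFin \o cst c).
Proof.
move=> mA Aoo; apply: measurable_bounded_integrable => //.
by exists `|c|; split => // M cM x _ /=; exact: ltW.
Qed.

(** The form in which the supporting line enters Jensen's inequality: the
    right-hand side may be infinite. *)
Lemma supporting_line_integral (A : set R) (v : R) (g : R -> R) (s m : R) :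
  measurable A -> mu A = v%:E ->
  (forall u, 0 <= u -> phi m + s * (u - m) <= phi u) ->
  measurable_fun setT g -> mu.-integrable A (EFin \o g) ->
  ((v * (phi m - s * m) + s * \int[mu]_(u in A) `|g u|)%:E <=
    \int[mu]_(u in A) (phi `|g u|)%:E)%E.
Proof.
move=> mA muA sP mg ig.
have phig0 u : A u -> (0 <= (phi `|g u|)%:E)%E by rewrite lee_fin (phi_ge0 phiP).
have [->|finphi] := eqVneq (\int[mu]_(u in A) (phi `|g u|)%:E)%E +oo%E.
  exact: leey.
have iphi : mu.-integrable A (EFin \o (fun u => phi `|g u|)).
  apply/integrableP; split.
    apply/measurable_EFinP; apply: measurable_funTS.
    exact: (measurableT_comp (measurable_phi_norm phiP)).
  under eq_integral do rewrite /= ger0_norm ?(phi_ge0 phiP)//.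
  by rewrite ltey.
have icst : mu.-integrable A (EFin \o cst (phi m - s * m)).
  by apply: integrable_cst_lty => //; rewrite muA ltry.
have iabs : mu.-integrable A (EFin \o (fun u => `|g u|)).
  exact: integrable_norm.
have isabs : mu.-integrable A (EFin \o (fun u => s * `|g u|)).
  exact: (@integrableZl _ (measurableTypeR R) _ mu _ mA s _ iabs).
rewrite -[leRHS]fineK ?ge0_fin_numE ?integral_ge0// ?ltey// lee_fin.
rewrite -[X in v * X]/(cst (phi m - s * m) m) -RintegralZl// mulrC.
have -> : (phi m - s * m) * v = \int[mu]_(u in A) cst (phi m - s * m) u.
  by rewrite Rintegral_cst// -[X in fine X]/(mu A) muA.
rewrite -RintegralD//; apply: le_Rintegral => //.
  exact: (@integrableD _ (measurableTypeR R) _ mu _ mA _ _ icst isabs).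
by move=> u _ /=; have := sP `|g u| (normr_ge0 _); lra.
Qed.

(** A single supporting line, at the weighted mean of the means of |G - y|,
    serves for the integrals and for the sum at once: the terms of degree one
    in its equation cancel after summation. *)
Lemma jensen_weighted_means (n : nat) (r : seq int) (A : int -> set R)
    (w : int -> R) (G : R -> R) (y : R) :
  (0 < n)%N ->
  (forall k, k \in r -> [/\ measurable (A k), mu (A k) = (n%:R^-1)%:E &
     mu.-integrable (A k) (EFin \o G)]) ->
  (forall k, 0 <= w k) -> 0 < \sum_(k <- r) w k -> measurable_fun setT G ->
  ((phi `|(\sum_(k <- r) n%:R * (\int[mu]_(u in A k) G u) * w k)
          / (\sum_(k <- r) w k) - y|)%:E <=
   ((\sum_(k <- r) w k)^-1 * n%:R)%:E *
     \sum_(k <- r) (w k)%:E * \int[mu]_(u in A k) (phi `|G u - y|)%:E)%E.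
Proof.
move=> n0 AP w0; set W := \sum_(k <- r) w k => W0 mG.
have n0' : 0 < n%:R :> R by rewrite ltr0n.
pose E k := n%:R * \int[mu]_(u in A k) `|G u - y|.
pose m := (\sum_(k <- r) w k * E k) / W.
have icy k : k \in r -> mu.-integrable (A k) (EFin \o cst y).
  by move=> /AP[mA muA _]; apply: integrable_cst_lty => //; rewrite muA ltry.
have iGy k : k \in r -> mu.-integrable (A k) (EFin \o (fun u => G u - y)).
  by move=> kr; have [mA muA iG] := AP _ kr;
    exact: (@integrableB _ (measurableTypeR R) _ mu _ mA _ _ iG (icy _ kr)).
have E0 k : 0 <= E k by rewrite mulr_ge0// Rintegral_ge0.
have m0 : 0 <= m.
  by rewrite divr_ge0 ?(ltW W0)//; apply: sumr_ge0 => k _; rewrite mulr_ge0.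
apply: (@le_trans _ _ (phi m)%:E).
  rewrite lee_fin (phi_le phiP)//.
  have -> : (\sum_(k <- r) n%:R * (\int[mu]_(u in A k) G u) * w k) / W - y =
      (\sum_(k <- r) w k * (n%:R * (\int[mu]_(u in A k) (G u - y)))) / W.
    transitivity ((\sum_(k <- r) (n%:R * (\int[mu]_(u in A k) G u) * w k - y * w k)) / W).
      by rewrite sumrB -mulr_sumr -/W; field; rewrite gt_eqF.
    congr (_ / _); apply: eq_big_seq => k kr; have [mA muA iG] := AP _ kr.
    rewrite RintegralB//; last exact: icy.
    rewrite Rintegral_cst// -[X in fine X]/(mu (A k)) muA/=.
    by field; rewrite gt_eqF.
  rewrite normrM (gtr0_norm (x := W^-1)) ?invr_gt0// ler_pM2r ?invr_gt0//.
  apply: (le_trans (ler_norm_sum _ _ _)); rewrite big_seq [leRHS]big_seq.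
  apply: ler_sum => k kr; rewrite normrM ger0_norm// ler_wpM2l// /E.
  rewrite normrM ger0_norm// ler_wpM2l//; have [mA _ _] := AP _ kr.
  by apply: le_normr_Rintegral => //; exact: iGy.
have [s s0 sP] := supporting_line phiP phi_cvx m0.
rewrite -(@lee_pmul2l _ (W / n%:R)%:E)// ?lte_fin ?divr_gt0//.
rewrite -[leLHS]EFinM muleA -[X in (_ <= X * _)%E]EFinM.
rewrite (_ : W / n%:R * (W^-1 * n%:R) = 1) ?mul1e; last by field; rewrite !gt_eqF.
have -> : (W / n%:R * phi m)%:E = (\sum_(k <- r) (w k)%:E *
    (n%:R^-1 * (phi m - s * m) + s * \int[mu]_(u in A k) `|G u - y|)%:E)%E.
  rewrite sumEFin; congr EFin.
  transitivity (\sum_(k <- r) ((phi m - s * m) / n%:R * w k + s / n%:R * (w k * E k))).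
    rewrite big_split/= -!mulr_sumr -/W.
    have -> : \sum_(k <- r) w k * E k = m * W by rewrite /m divfK// gt_eqF.
    by field; rewrite gt_eqF.
  by apply: eq_bigr => k _; rewrite /E; field; rewrite gt_eqF.
rewrite big_seq [leRHS]big_seq; apply: lee_sum => k kr.
rewrite lee_wpmul2l ?lee_fin//; have [mA muA iG] := AP _ kr.
apply: (supporting_line_integral (g := fun u => G u - y)) => //.
- exact: measurable_funB.
- exact: iGy.
Qed.

End jensen.

(** * Increments over long shifts *)

Section core.
Context {R : realType}.
Local Notation mu := (@lebesgue_measure R).
Variable phi : R -> R.
Hypotheses (phiP : phi_function phi) (phi_cvx : convex_phi phi).
Variable C : R.
Hypotheses (C0 : 0 < C)
  (phiC : forall u v, 0 <= u -> 1 <= v -> phi (u * v) <= C * phi u * phi v).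
Variables (a T : R) (G : R -> R).
Hypotheses (T0 : 0 < T) (mG : measurable_fun setT G).
Hypothesis G_per : forall (k : int) x, G (x + k%:~R * T) = G x.

Lemma measurable_phi_shift (c d : R) :
  measurable_fun setT (fun x : R => phi `|G (x + c) - G (x + d)|).
Proof.
apply: (measurableT_comp (measurable_phi_norm phiP)).
by apply: measurable_funB; apply: (measurableT_comp mG); exact: measurable_funD.
Qed.

Variables (delta S : R).
Hypothesis small_shift : forall h, `|h| <= delta ->
  (\int[mu]_(x in `[a, (a + T)%R]) (phi `|G (x + h) - G x|)%:E <= S%:E)%E.

(** The increment over h telescopes into m increments over h / m.  Jensen's
    inequality and the Delta' condition bound phi of their sum by C phi m times
    the mean of the values of phi, and each of the m increments is a
    translate of the first one, so has the same integral over a period. *)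
Lemma long_shift (m : nat) (h : R) : (0 < m)%N -> `|h| <= m%:R * delta ->
  (\int[mu]_(x in `[a, (a + T)%R]) (phi `|G (x + h) - G x|)%:E
    <= (C * phi m%:R * S)%:E)%E.
Proof.
move=> m0 hm; have m0' : 0 < m%:R :> R by rewrite ltr0n.
pose t := h / m%:R.
have tdelta : `|t| <= delta.
  by rewrite normrM normfV (gtr0_norm m0') ler_pdivrMr// mulrC.
pose v j x := `|G (x + (j.+1)%:R * t) - G (x + j%:R * t)|.
have cphi0 : 0 <= m%:R^-1 * (C * phi m%:R).
  by rewrite !mulr_ge0 ?invr_ge0 ?(ltW C0) ?(phi_ge0 phiP).
have telescope x : phi `|G (x + h) - G x| <=
    m%:R^-1 * (C * phi m%:R) * \sum_(j < m) phi (v j x).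
  have -> : G (x + h) - G x =
      \sum_(0 <= j < m) (G (x + (j.+1)%:R * t) - G (x + j%:R * t)).
    rewrite telescope_sumr// mul0r addr0; congr (G (x + _) - _).
    by rewrite /t mulrC divfK// gt_eqF.
  rewrite big_mkord; apply: (@le_trans _ _ (phi (\sum_(j < m) v j x))).
    by rewrite (phi_le phiP)//; exact: ler_norm_sum.
  apply: (le_trans (phi_sum phiP phi_cvx (v := v ^~ x) m0 _)).
    by move=> j; exact: normr_ge0.
  rewrite -mulrA ler_wpM2l ?invr_ge0// mulr_sumr; apply: ler_sum => j _.
  rewrite mulrAC; apply: phiC; [exact: normr_ge0|by rewrite ler1n].
have mv j : measurable_fun setT (fun x => (phi (v j x))%:E).
  by apply/measurable_EFinP; exact: measurable_phi_shift.
have v0 j x : (0 <= (phi (v j x))%:E)%E by rewrite lee_fin (phi_ge0 phiP)// /v.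
have mI : measurable (`[a, a + T]%classic : set R) by exact: measurable_itv.
have vS j : (\int[mu]_(x in `[a, (a + T)%R]) (phi (v j x))%:E <= S%:E)%E.
  apply: le_trans (small_shift tdelta).
  rewrite -(@ge0_integral_periodic_translate _ a T
    (fun x => (phi `|G (x + t) - G x|)%:E) T0 _ _ _ (j%:R * t)); last 3 first.
  - apply/measurable_EFinP; under eq_fun do rewrite -[X in _ - G X]addr0.
    exact: measurable_phi_shift.
  - by move=> x; rewrite lee_fin (phi_ge0 phiP).
  - by move=> k x; rewrite addrAC !G_per.
  rewrite le_eqVlt; apply/orP; left; apply/eqP; apply: eq_integral => x _.
  by rewrite /v -addrA -[in LHS]addn1 natrD mulrDl mul1r.
apply: (@le_trans _ _ (\int[mu]_(x in `[a, (a + T)%R])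
    ((m%:R^-1 * (C * phi m%:R))%:E * \sum_(j < m) (phi (v j x))%:E))%E).
  apply: ge0_le_integral => //.
  - by move=> x _; rewrite lee_fin (phi_ge0 phiP).
  - apply: measurable_funTS; apply/measurable_EFinP.
    under eq_fun do rewrite -[X in _ - G X]addr0.
    exact: measurable_phi_shift.
  - apply: measurable_funTS; apply: measurable_funeM.
    by apply: emeasurable_sum => j; exact: mv.
  - by move=> x _; rewrite sumEFin -EFinM lee_fin.
rewrite ge0_integralZl_EFin//; last 2 first.
- by move=> x _; apply: sume_ge0.
- by apply: measurable_funTS; apply: emeasurable_sum => j; exact: mv.
rewrite ge0_integral_sum//; last by move=> j; apply: measurable_funTS; exact: mv.
apply: (@le_trans _ _ ((m%:R^-1 * (C * phi m%:R))%:E * \sum_(j < m) S%:E)%E).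
  by rewrite lee_wpmul2l ?lee_fin//; apply: lee_sum => j _; exact: vS.
rewrite sumEFin sumr_const card_ord -EFinM lee_fin -(mulr_natr S).
rewrite le_eqVlt; apply/orP; left; apply/eqP; field; rewrite gt_eqF//.
Qed.

End core.

(** * The kernel of the operator *)

Section kernel.
Context {R : realType}.
Local Notation mu := (@lebesgue_measure R).
Variable sigma : R -> R.
Hypothesis sigmaP : sigmoidal sigma.
Variable n : nat.
Hypothesis n0 : (0 < n)%N.

(** At most one term is nonzero, the one where k is the integer part of n u;
    then n u - k is in [0, 1[ and n x - k is its difference with n (u - x). *)
Lemma density_sum_indic_le (r : seq int) (x u : R) : uniq r ->
  \sum_(k <- r) density sigma (n%:R * x - k%:~R) * (Num.floor (n%:R * u) == k)%:R <=
  bandwidth sigma `|Num.floor (n%:R * (u - x))|%N.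
Proof.
move=> ur; set q := Num.floor (n%:R * u).
have [qr|qr] := boolP (q \in r); last first.
  rewrite big_seq big1 ?bandwidth_ge0// => k kr.
  by case: eqP => [qk|_]; [rewrite qk kr in qr|rewrite mulr0].
rewrite (bigD1_seq q)//= eqxx mulr1 big1 ?addr0; last first.
  by move=> k kq; rewrite eq_sym (negPf kq) mulr0.
have -> : n%:R * x - q%:~R = (n%:R * u - q%:~R) - n%:R * (u - x) by ring.
apply: density_le_bandwidth => //.
have /andP[h1 h2] : q%:~R <= n%:R * u < (q + 1)%:~R by rewrite /q floor_itv.
by rewrite intrD in h2; apply/andP; split; lra.
Qed.

Lemma measurable_floor_eq (k : int) :
  measurable_fun setT (fun u : R => (Num.floor (n%:R * u) == k)%:R : R).
Proof.
rewrite (_ : (fun u => _) = \1_[set u | Num.floor (n%:R * u) = k]).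
  by apply: measurable_indic; rewrite floor_level//; exact: measurable_itv.
apply/funext => u; rewrite indicE; congr (_%:R).
by case: eqP => h; [rewrite mem_set|rewrite memNset].
Qed.

(** This is where the nodes disappear: the substitution u = x + h replaces the
    sum over the cells by an integral against a kernel in n h. *)
Lemma weighted_cells_le (r : seq int) (x : R) (F : R -> R) : uniq r ->
  measurable_fun setT F -> (forall u, 0 <= F u) ->
  (\sum_(k <- r) (density sigma (n%:R * x - k%:~R))%:E *
      \int[mu]_(u in cell n k) (F u)%:E
    <= \int[mu]_h (bandwidth sigma `|Num.floor (n%:R * h)|%N * F (x + h))%:E)%E.
Proof.
move=> ur mF F0.
have mwF k : measurable_fun setT (fun u : R => (density sigma (n%:R * x - k%:~R) *
    (Num.floor (n%:R * u) == k)%:R * F u)%:E).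
  apply/measurable_EFinP; apply: measurable_funM => //; apply: measurable_funM => //.
  exact: measurable_floor_eq.
have wF0 k u : (0 <= (density sigma (n%:R * x - k%:~R) *
    (Num.floor (n%:R * u) == k)%:R * F u)%:E)%E.
  by rewrite lee_fin mulr_ge0// mulr_ge0// density_ge0.
have mbF : measurable_fun setT
    (fun u : R => bandwidth sigma `|Num.floor (n%:R * (u - x))|%N * F u).
  apply: measurable_funM => //.
  apply: (@measurableT_comp _ _ _ _ _ _
    (fun h : R => bandwidth sigma `|Num.floor (n%:R * h)|%N)).
    exact: measurable_absz_floor.
  exact: measurable_funB.
rewrite (_ : (\int[mu]_h _)%E = (\int[mu]_u
    (bandwidth sigma `|Num.floor (n%:R * (u - x))|%N * F u)%:E)%E); last first.
  rewrite -[RHS](ge0_integral_translate x)//.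
  - rewrite preimage_setT; apply: eq_integral => h _.
    by rewrite addrK addrC.
  - exact/measurable_EFinP.
  - by move=> u; rewrite lee_fin mulr_ge0// bandwidth_ge0.
rewrite (eq_bigr (fun k => \int[mu]_u ((density sigma (n%:R * x - k%:~R) *
    (Num.floor (n%:R * u) == k)%:R * F u)%:E))%E); last first.
  move=> k _.
  have -> : (\int[mu]_(u in cell n k) (F u)%:E =
      \int[mu]_u ((Num.floor (n%:R * u) == k)%:R * F u)%:E)%E.
    rewrite /cell -integral_itv_bndo_bndc; last first.
      by apply/measurable_EFinP; apply: measurable_funTS.
    rewrite -floor_level// integral_mkcond; apply: eq_integral => u _.
    rewrite patchE; case: ifPn => [/set_mem/= ->|]; first by rewrite eqxx mul1r.
    by case: eqP => [? /negP[]|_ _]; [rewrite inE|rewrite mul0r].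
  rewrite -ge0_integralZl_EFin//; last 3 first.
  - by move=> u _; rewrite lee_fin mulr_ge0.
  - apply/measurable_EFinP; apply: measurable_funM => //.
    exact: measurable_floor_eq.
  - exact: density_ge0.
  by apply: eq_integral => u _; rewrite -EFinM mulrA.
rewrite -ge0_integral_sum//.
apply: ge0_le_integral => //.
- by move=> u _; apply: sume_ge0 => k _; exact: wF0.
- apply: emeasurable_sum => k; exact: mwF.
- exact/measurable_EFinP.
move=> u _; rewrite sumEFin lee_fin -mulr_suml ler_wpM2r//.
exact: density_sum_indic_le.
Qed.

End kernel.

(** * The estimate for Borel functions *)

Lemma measurable_node_average (R : realType) (sigma : R -> R) (n : nat)
    (r : seq int) (c : int -> R) : sigmoidal sigma ->
  measurable_fun setT (fun x : R =>
    (\sum_(k <- r) c k * density sigma (n%:R * x - k%:~R)) /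
    \sum_(k <- r) density sigma (n%:R * x - k%:~R)).
Proof.
move=> sigmaP.
have mdens (k : int) : measurable_fun setT (fun x : R => density sigma (n%:R * x - k%:~R)).
  apply: (measurableT_comp (measurable_density sigmaP)).
  by apply: measurable_funB => //; exact: measurable_funM.
apply: measurable_funM.
  by apply: measurable_sum => k; apply: measurable_funM.
(* On nonnegative arguments, inversion is a (measurable) power function. *)
rewrite (_ : (fun x => _) = (fun y : R => y `^ (-1)) \o
    (fun x => \sum_(k <- r) density sigma (n%:R * x - k%:~R))).
  apply: (measurableT_comp (measurable_powR _)).
  by apply: measurable_sum => k; exact: mdens.
apply/funext => x /=; rewrite powR_inv1// sumr_ge0// => k _.
exact: density_ge0.
Qed.

Section borel_estimate.
Context {R : realType}.
Local Notation mu := (@lebesgue_measure R).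
Variables (sigma phi : R -> R) (C : R).
Hypotheses (sigmaP : sigmoidal sigma) (phiP : phi_function phi)
  (phi_cvx : convex_phi phi) (C0 : 0 < C)
  (phiC : forall u v, 0 <= u -> 1 <= v -> phi (u * v) <= C * phi u * phi v).
Variables (a T : R) (G : R -> R).
Hypotheses (T0 : 0 < T) (mG : measurable_fun setT G)
  (G_per : forall (k : int) x, G (x + k%:~R * T) = G x).
Variables (n : nat) (r : seq int) (S : R).
Hypotheses (n0 : (0 < n)%N) (ur : uniq r) (S0 : 0 <= S)
  (small_shift : forall h, `|h| <= n%:R^-1 ->
    (\int[mu]_(x in `[a, (a + T)%R]) (phi `|G (x + h) - G x|)%:E <= S%:E)%E)
  (G_int : forall k, k \in r -> mu.-integrable (cell n k) (EFin \o G))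
  (r_dense : forall x, a <= x <= a + T ->
    density_gap sigma <= \sum_(k <- r) density sigma (n%:R * x - k%:~R)).
Let n0' : 0 < n%:R :> R. Proof. by rewrite ltr0n. Qed.

Let K (x : R) := (\sum_(k <- r) n%:R * (\int[mu]_(u in cell n k) G u) *
    density sigma (n%:R * x - k%:~R)) /
  \sum_(k <- r) density sigma (n%:R * x - k%:~R).

Let J (x h : R) := bandwidth sigma `|Num.floor (n%:R * h)|%N * phi `|G (x + h) - G x|.

Let J0 x h : 0 <= J x h.
Proof. by rewrite mulr_ge0 ?bandwidth_ge0 ?(phi_ge0 phiP). Qed.

Let mJ : measurable_fun setT
  (fun z : measurableTypeR R * measurableTypeR R => J z.1 z.2).
Proof.
apply: measurable_funM.
  apply: (@measurableT_comp _ _ _ _ _ _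
    (fun h : R => bandwidth sigma `|Num.floor (n%:R * h)|%N)).
    exact: measurable_absz_floor.
  exact: measurable_snd.
apply: (measurableT_comp (measurable_phi_norm phiP)).
apply: measurable_funB; apply: (measurableT_comp mG) => //.
exact: measurable_funD.
Qed.

Let kantorovich_pointwise x : a <= x <= a + T ->
  ((phi `|K x - G x|)%:E <= (n%:R / density_gap sigma)%:E * \int[mu]_h (J x h)%:E)%E.
Proof.
move=> aT; have d0 := density_gap_gt0 sigmaP; have dW := r_dense aT.
have W0 : 0 < \sum_(k <- r) density sigma (n%:R * x - k%:~R) by exact: lt_le_trans dW.
apply: le_trans.
  apply: (jensen_weighted_means phiP phi_cvx (G x) n0 (A := cell n)) => //.
    move=> k kr; split; [exact: measurable_itv|exact: lebesgue_measure_cell|exact: G_int].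
  by move=> k; exact: density_ge0.
apply: lee_pmul.
- by rewrite lee_fin mulr_ge0// invr_ge0 ltW.
- apply: sume_ge0 => k _; rewrite mule_ge0 ?lee_fin ?density_ge0//.
  by apply: integral_ge0 => u _; rewrite lee_fin (phi_ge0 phiP).
- by rewrite lee_fin mulrC ler_pM2l// lef_pV2.
apply: (weighted_cells_le sigmaP n0 x ur (F := fun u => phi `|G u - G x|)).
- exact: measurable_phi_normB.
- by move=> u; rewrite (phi_ge0 phiP).
Qed.

(** Integrating the pointwise bound over x and exchanging the two integrals
    leaves, for each h, the integral of an increment over the shift h, to which
    [long_shift] applies with m + 1 short shifts. *)
Lemma borel_estimate :
  (\int[mu]_(x in `[a, (a + T)%R]) (phi `|K x - G x|)%:E <=
    (2 * C / density_gap sigma * S)%:E *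
    \sum_(0 <= m <oo) (bandwidth sigma m * phi m.+1%:R)%:E)%E.
Proof.
have d0 := density_gap_gt0 sigmaP.
have mI : measurable (`[a, (a + T)%R]%classic : set R) by exact: measurable_itv.
have mEJ : measurable_fun setT
  (fun z : measurableTypeR R * measurableTypeR R => (J z.1 z.2)%:E).
  exact/measurable_EFinP.
pose f (z : measurableTypeR R * measurableTypeR R) : \bar R :=
  (\1_(`[a, (a + T)%R]%classic : set R) z.1 * J z.1 z.2)%:E.
have f0 z : (0 <= f z)%E by rewrite lee_fin mulr_ge0.
have mf : measurable_fun setT f.
  apply/measurable_EFinP; apply: measurable_funM => //.
  apply: (measurableT_comp (measurable_indic _)) => //; exact: measurable_fst.
have intf1 x : (\int[mu]_h f (x, h) =
    ((fun x => \int[mu]_h (J x h)%:E) \_ `[a, (a + T)%R]) x)%E.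
  rewrite patchE /f/= indicE; case: ifPn => xI.
    by apply: eq_integral => h _; rewrite mul1r.
  by apply: integral0_eq => h _; rewrite mul0r.
have intf2 h : (\int[mu]_x f (x, h) = \int[mu]_(x in `[a, (a + T)%R]) (J x h)%:E)%E.
  rewrite [RHS]integral_mkcond; apply: eq_integral => x _.
  by rewrite patchE /f/= indicE; case: ifPn => _; rewrite ?mul1r ?mul0r.
have mF : measurable_fun setT (fun x : R => (\int[mu]_h (J x h)%:E)%E).
  have EJ0 (z : measurableTypeR R * measurableTypeR R) : (0 <= (J z.1 z.2)%:E)%E.
    by rewrite lee_fin.
  exact: (measurable_fun_fubini_tonelli_F (m2 := mu) _ mEJ EJ0).
have mshift h : measurable_fun setT (fun x : R => (phi `|G (x + h) - G x|)%:E).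
  apply/measurable_EFinP; under eq_fun do rewrite -[X in _ - G X]addr0.
  exact: (measurable_phi_shift phiP mG h 0).
have mK0 : measurable_fun setT K.
  exact: (measurable_node_average n r (fun k => n%:R * \int[mu]_(u in cell n k) G u) sigmaP).
have mK : measurable_fun setT (fun x => (phi `|K x - G x|)%:E).
  apply/measurable_EFinP; apply: (measurableT_comp (measurable_phi_norm phiP)).
  by apply: measurable_funB.
apply: (@le_trans _ _ (\int[mu]_(x in `[a, (a + T)%R])
    ((n%:R / density_gap sigma)%:E * \int[mu]_h (J x h)%:E))%E).
  apply: ge0_le_integral => //.
  - by move=> x _; rewrite lee_fin (phi_ge0 phiP).
  - exact: measurable_funTS.
  - by apply: measurable_funTS; apply: measurable_funeM.
rewrite ge0_integralZl_EFin//; last 3 first.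
- by move=> x _; apply: integral_ge0 => h _; rewrite lee_fin.
- exact: measurable_funTS.
- by rewrite divr_ge0 ?ltW.
have -> : (\int[mu]_(x in `[a, (a + T)%R]) \int[mu]_h (J x h)%:E =
    \int[mu]_h \int[mu]_(x in `[a, (a + T)%R]) (J x h)%:E)%E.
  rewrite integral_mkcond.
  transitivity (\int[mu]_x \int[mu]_h f (x, h))%E.
    by apply: eq_integral => x _; rewrite intf1.
  rewrite (fubini_tonelli (m1 := mu) (m2 := mu) f mf f0).
  by apply: eq_integral => h _; rewrite intf2.
apply: (@le_trans _ _ ((n%:R / density_gap sigma)%:E *
    \int[mu]_h ((C * S)%:E * ((fun m => bandwidth sigma m * phi m.+1%:R)
       `|Num.floor (n%:R * h)|%N)%:E))%E).
  rewrite lee_wpmul2l ?lee_fin ?divr_ge0 ?(ltW d0)//.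
  apply: ge0_le_integral => //.
  - by move=> h _; apply: integral_ge0 => x _; rewrite lee_fin.
  - under eq_fun do rewrite -intf2.
    exact: (measurable_fun_fubini_tonelli_G (m1 := mu) _ mf f0).
  - apply: measurable_funeM; apply/measurable_EFinP.
    exact: (measurable_absz_floor (fun m => bandwidth sigma m * phi m.+1%:R)).
  move=> h _; rewrite /J; set m := `|_|%N.
  under eq_integral do rewrite EFinM.
  rewrite ge0_integralZl_EFin ?bandwidth_ge0//; last 2 first.
  - by move=> x _; rewrite lee_fin (phi_ge0 phiP).
  - by apply: measurable_funTS; exact: mshift.
  apply: (@le_trans _ _ ((bandwidth sigma m)%:E * (C * phi m.+1%:R * S)%:E)%E).
    rewrite lee_wpmul2l ?lee_fin ?bandwidth_ge0//.
    apply: (long_shift phiP phi_cvx C0 phiC T0 mG G_per small_shift) => //.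
    rewrite ler_pdivlMr// -[X in _ * X](gtr0_norm n0') -normrM mulrC.
    have /andP[h1 h2] : (Num.floor (n%:R * h))%:~R <= n%:R * h <
      (Num.floor (n%:R * h) + 1)%:~R by rewrite floor_itv.
    rewrite intrD in h2; rewrite ler_norml -natr1.
    have h3 : `|(Num.floor (n%:R * h))%:~R : R| = m%:R by rewrite -intr_norm.
    have := ler_norm ((Num.floor (n%:R * h))%:~R : R).
    have := ler_norm (- (Num.floor (n%:R * h))%:~R : R).
    by rewrite normrN h3 => h4 h5; apply/andP; split; lra.
  by rewrite -!EFinM lee_fin le_eqVlt; apply/orP; left; apply/eqP; ring.
rewrite ge0_integralZl_EFin//; last 3 first.
- by move=> h _; rewrite lee_fin mulr_ge0 ?bandwidth_ge0 ?(phi_ge0 phiP).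
- apply/measurable_EFinP.
  exact: (measurable_absz_floor (fun m => bandwidth sigma m * phi m.+1%:R)).
- by rewrite mulr_ge0// ltW.
rewrite muleA -EFinM.
apply: (@le_trans _ _ ((n%:R / density_gap sigma * (C * S))%:E *
  ((2 / n%:R)%:E * \sum_(0 <= m <oo) (bandwidth sigma m * phi m.+1%:R)%:E))%E).
  rewrite lee_wpmul2l ?lee_fin ?mulr_ge0 ?invr_ge0 ?(ltW d0) ?(ltW C0)//.
  apply: (integral_absz_floor_le (H := fun m => bandwidth sigma m * phi m.+1%:R)) => //.
  by move=> m; rewrite mulr_ge0 ?bandwidth_ge0 ?(phi_ge0 phiP).
rewrite muleA -EFinM le_eqVlt; apply/orP; left; apply/eqP; congr (_%:E * _)%E.
by field; rewrite !gt_eqF.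
Qed.

End borel_estimate.

(** * Borel representatives of Lebesgue measurable functions *)

Section borel_representative.
Context {R : realType}.
Local Notation mu := (@lebesgue_measure R).
Local Notation leb := (@completed_lebesgue_measure R).

Lemma measurable_lebesgue_line (A : set R) : measurable A ->
  measurable (A : set (lebesgue_line R)).
Proof. by move=> mA; exact: sub_caratheodory. Qed.

Lemma measurable_fun_lebesgue_line (D : set R) (F : R -> \bar R) :
  measurable D -> measurable_fun D F ->
  @measurable_fun _ _ (lebesgue_line R) _ D F.
Proof.
by move=> mD mF _ Y mY; apply: measurable_lebesgue_line; exact: mF.
Qed.

Lemma ge0_integral_completed (D : set R) (F : R -> \bar R) :
  measurable D -> measurable_fun setT F -> (forall x, 0 <= F x)%E ->
  (\int[leb]_(x in (D : set (lebesgue_line R))) F x = \int[mu]_(x in D) F x)%E.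
Proof.
move=> mD mF F0.
have mid : @measurable_fun _ _ (lebesgue_line R) (measurableTypeR R) setT (@id R).
  by move=> _ Y mY; rewrite setTI; exact: measurable_lebesgue_line.
rewrite -[LHS]/(\int[leb]_(x in (@id R) @^-1` D) (F \o @id R) x)%E.
by rewrite -(@ge0_integral_pushforward _ _ _ _ _ _ mid)//; exact: measurable_funTS.
Qed.

Lemma integral_completed (D : set R) (F : R -> \bar R) :
  measurable D -> measurable_fun setT F ->
  (\int[leb]_(x in (D : set (lebesgue_line R))) F x = \int[mu]_(x in D) F x)%E.
Proof.
move=> mD mF; rewrite integralE [RHS]integralE; congr (_ - _)%E;
  apply: ge0_integral_completed => //.
- exact: (measurable_funepos mF).
- exact: (measurable_funeneg mF).
Qed.

(** Completeness makes F measurable as soon as it agrees almost everywhere with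
    a Borel function. *)
Lemma integral_completed_ae (D Z : set R) (F H : R -> \bar R) :
  measurable D -> measurable_fun setT H -> measurable Z -> mu Z = 0%E ->
  (forall x, D x -> ~ Z x -> F x = H x) ->
  (\int[leb]_(x in (D : set (lebesgue_line R))) F x = \int[mu]_(x in D) H x)%E.
Proof.
move=> mD mH mZ Z0 FH; rewrite -integral_completed//.
have HF : ae_eq leb (D : set (lebesgue_line R)) H F.
  exists Z; split; [exact: measurable_lebesgue_line|exact: Z0|].
  by move=> x /= nFH; apply: contrapT => nZ; apply: nFH => Dx; rewrite FH.
have mD' := measurable_lebesgue_line mD.
have mH' : @measurable_fun _ _ (lebesgue_line R) _ D H.
  by apply: measurable_fun_lebesgue_line => //; exact: measurable_funTS.
apply: ae_eq_integral => //; last exact: ae_eq_sym.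
exact: (ae_measurable_fun completed_lebesgue_measure_is_complete HF).
Qed.

Lemma caratheodory_borel_up_to_null (E : set R) :
  measurable (E : set (lebesgue_line R)) ->
  exists X N : set R, [/\ measurable X, mu.-negligible N & E = X `|` N].
Proof.
move=> mE.
have : (completed_algebra_gen mu).-sigma.-measurable E.
  by rewrite completed_caratheodory_measurable; exact: mE.
rewrite g_sigma_completed_algebra_genE => -[X mX [N negN] XN].
by exists X, N; split.
Qed.

(** For each rational q the set of the x in D with f x > q is Borel up to a null
    set.  These countably many null sets lie in a Borel null set N, and outside
    of N the function f is Borel. *)
Lemma borel_representative (D : set R) (f : R -> R) : measurable D ->
  @measurable_fun _ _ (lebesgue_line R) _ D f ->
  exists g N, [/\ measurable_fun setT (g : R -> R), measurable N, mu N = 0%E &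
    forall x, D x -> ~ N x -> f x = g x].
Proof.
move=> mD mf; pose q (i : nat) : R := ratr (odflt 0 (unpickle i)).
pose E i := D `&` f @^-1` `]q i, +oo[.
have mE i : measurable (E i : set (lebesgue_line R)).
  apply: mf; first exact: measurable_lebesgue_line.
  exact: measurable_itv.
pose X i := projT1 (cid (caratheodory_borel_up_to_null (mE i))).
have /choice[M XM] i : exists M, [/\ measurable (X i), mu.-negligible M & E i = X i `|` M].
  by rewrite /X; case: cid.
have [N [mN N0 MN]] : mu.-negligible (\bigcup_i M i).
  by apply: negligible_bigcup => i; case: (XM i).
exists (f \_ (D `\` N)), N; split => //; last first.
  by move=> x Dx Nx; rewrite patchE mem_set.
have mDN : measurable (D `\` N) by exact: measurableD.
apply: (iffLR (measurable_restrictT _ mDN)).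
apply: (measurability (@RGenOInfty.G R)) => [|/= _ [_] [y] -> <-].
  exact: RGenOInfty.measurableE.
rewrite (_ : _ `&` _ = \bigcup_(i in [set i | y < q i]) (X i `&` (D `\` N))).
  by apply: bigcup_measurable => i _; apply: measurableI => //; case: (XM i).
apply/seteqP; split => x /=.
  rewrite in_itv/= andbT => -[[Dx Nx] yf].
  have [p] := rat_in_itvoo yf; rewrite in_itv/= => /andP[yp pf].
  have qp : q (pickle p) = ratr p by rewrite /q pickleK.
  exists (pickle p); first by rewrite /= qp.
  split => //; have : E (pickle p) x by split => //=; rewrite in_itv/= qp pf.
  have [_ _ ->] := XM (pickle p); case=> // Mx; exfalso; apply: Nx; apply: MN.
  by exists (pickle p).
move=> [i /= yq [Xx [Dx Nx]]]; split => //.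
have : E i x by have [_ _ ->] := XM i; left.
by move=> [_ /=]; rewrite !in_itv/= !andbT; exact: lt_trans.
Qed.

End borel_representative.

(** * Periodization *)

(** The representative of x modulo b - a in [a, b[: the point at which a
    periodization evaluates its argument. *)
Definition fold (R : realType) (a b x : R) : R :=
  x - (Num.floor ((x - a) / (b - a)))%:~R * (b - a).

Section periodization_theory.
Context {R : realType}.
Local Notation mu := (@lebesgue_measure R).
Variables a b : R.
Hypothesis ab : a < b.
Let T0 : 0 < b - a. Proof. by rewrite subr_gt0. Qed.

Lemma fold_itv x : a <= fold a b x < b.
Proof.
have /andP[] : (Num.floor ((x - a) / (b - a)))%:~R <= (x - a) / (b - a) <
   (Num.floor ((x - a) / (b - a)) + 1)%:~R by rewrite floor_itv.
rewrite /fold; move: (Num.floor _) => q.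
rewrite ler_pdivlMr// ltr_pdivrMr// intrD mulrDl mul1r => h1 h2.
by apply/andP; split; lra.
Qed.

Lemma fold_id x : a <= x < b -> fold a b x = x.
Proof.
move=> /andP[ax xb]; rewrite /fold (_ : Num.floor _ = 0) ?mul0r ?subr0//.
apply: floor_def; rewrite add0r mulr0z mulr1z ler_pdivlMr// ltr_pdivrMr//.
by rewrite mul0r mul1r subr_ge0 ax/= ltrD2r.
Qed.

Lemma fold_periodic (k : int) x : fold a b (x + k%:~R * (b - a)) = fold a b x.
Proof.
rewrite /fold (_ : (x + _ - a) / (b - a) = (x - a) / (b - a) + k%:~R); last first.
  by field; rewrite gt_eqF.
by rewrite floorDrz ?intr_int// intrKfloor intrD; ring.
Qed.

Lemma measurable_fold : measurable_fun setT (fold a b).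
Proof.
apply: measurable_funB => //; apply: measurable_funM => //.
apply: (@measurableT_comp _ _ _ _ _ _ (fun y : R => (Num.floor y)%:~R : R)).
  by apply: nondecreasing_measurable => // x y xy; rewrite ler_int le_floor.
by apply: measurable_funM => //; exact: measurable_funB.
Qed.

Lemma periodization_periodic F (k : int) x :
  periodization a b F (x + k%:~R * (b - a)) = periodization a b F x.
Proof. by rewrite -[LHS]/(F (fold a b _)) fold_periodic. Qed.

Lemma measurable_periodization F : measurable_fun setT F ->
  measurable_fun setT (periodization a b F).
Proof. by move=> mF; exact: (measurableT_comp mF measurable_fold). Qed.

Variables (f g : R -> R) (N : set R).
Hypotheses (mN : measurable N) (N0 : mu N = 0%E)
  (fg : forall x, `[a, b]%classic x -> ~ N x -> f x = g x).

(** The indicator of the periodic extension of N is periodic, so its integral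
    over [a, b] is not changed by a translation; without translation it
    is at most the measure of N and the endpoint b. *)
Lemma fold_null_translate h :
  measurable (`[a, b]%classic `&` [set x | N (fold a b (x + h))]) /\
  mu (`[a, b]%classic `&` [set x | N (fold a b (x + h))]) = 0%E.
Proof.
have mP c : measurable [set x : R | N (fold a b (x + c))].
  rewrite -[X in measurable X]setTI; apply: (measurableT_comp measurable_fold) => //.
  exact: measurable_funD.
have mI : measurable (`[a, b]%classic : set R) by exact: measurable_itv.
split; first exact: measurableI.
have E c : mu (`[a, b]%classic `&` [set x | N (fold a b (x + c))]) =
    (\int[mu]_(x in `[a, b]) (\1_[set x | N (fold a b x)] (x + c))%:E)%E.
  by rewrite setIC -integral_indic//; exact: mP.
have := @ge0_integral_periodic_translate R a (b - a)
  (fun x => (\1_[set x | N (fold a b x)] x)%:E) T0 _ _ _ h.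
rewrite [(a + (b - a))%R]addrC subrK E => -> //; last 2 first.
- apply/measurable_EFinP; apply: measurable_indic.
  rewrite (_ : [set _ | _] = [set x | N (fold a b (x + 0))])//.
  by apply/funext => x /=; rewrite addr0.
- move=> k x; rewrite !indicE.
  suff -> : (x + k%:~R * (b - a) \in [set x | N (fold a b x)]) =
    (x \in [set x | N (fold a b x)]) by [].
  by apply/idP/idP; rewrite !inE/= fold_periodic.
transitivity (\int[mu]_(x in `[a, b]) (\1_[set x | N (fold a b x)] (x + 0)%R)%:E)%E.
  by apply: eq_integral => x _; rewrite addr0.
rewrite -E; apply/eqP; rewrite -measure_le0.
apply: (@le_trans _ _ (mu (N `|` [set b]))).
  apply: le_measure; rewrite ?inE.
  - by apply: measurableI => //; exact: mP.
  - by apply: measurableU.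
  move=> x [/=]; rewrite in_itv/= addr0 => /andP[ax xb].
  have [->|xb'] := eqVneq x b; first by right.
  by rewrite fold_id ?ax ?lt_neqAle ?xb'//; left.
rewrite le_eqVlt; apply/orP; left; apply/eqP.
by apply: null_set_setU => //; exact: lebesgue_measure_set1.
Qed.

Lemma periodizationE x : ~ N (fold a b x) -> periodization a b f x = periodization a b g x.
Proof.
move=> Nx; apply: fg => //=; have /andP[h1 h2] := fold_itv x.
by rewrite in_itv/= h1 ltW.
Qed.

Lemma eq_periodization x : a <= x < b -> ~ N x -> f x = periodization a b g x.
Proof.
move=> xab Nx; rewrite -[RHS]/(g (fold a b x)) fold_id// fg//=.
by move/andP : xab => [h1 h2]; rewrite in_itv/= h1 ltW.
Qed.

End periodization_theory.

(** * Nodes, and integrability of Orlicz functions *)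

Section nodes_theory.
Context {R : realType}.
Local Notation mu := (@lebesgue_measure R).
Variables (a b : R) (n : nat).
Hypotheses (n0 : (0 < n)%N) (adm : admissible a b n).
Let n0' : 0 < n%:R :> R. Proof. by rewrite ltr0n. Qed.

(** The finite set of nodes as a duplicate-free list, over which ordinary big
    operators can be used. *)
Definition node_seq : seq int :=
  let lo := Num.ceil (n%:R * a) in
  [seq lo + i%:Z | i <- iota 0 `|Num.floor (n%:R * b) - lo|%N].

Lemma node_seq_uniq : uniq node_seq.
Proof. by rewrite map_inj_uniq ?iota_uniq// => i j /addrI[]. Qed.

Lemma mem_node_seq k : (k \in node_seq) =
  (Num.ceil (n%:R * a) <= k <= Num.floor (n%:R * b) - 1).
Proof.
move: adm; rewrite /admissible /node_seq; set lo := Num.ceil _; set hi := Num.floor _.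
move=> lohi; apply/mapP/idP => [[i]|/andP[lk kh]].
  by rewrite mem_iota => /andP[_ i_lt] ->; lia.
by exists `|k - lo|%N; [rewrite mem_iota; lia|lia].
Qed.

Lemma fsum_nodes (F : int -> R) : \sum_(k \in nodes a b n) F k = \sum_(k <- node_seq) F k.
Proof.
rewrite (fsbig_seq _ _ node_seq_uniq); apply: eq_fsbigl.
by apply/seteqP; split => k; rewrite /= mem_node_seq.
Qed.

Lemma cell_nodes k : k \in node_seq -> (cell n k : set R) `<=` `[a, b].
Proof.
rewrite mem_node_seq => /andP[lk kh] u; rewrite /cell/= !in_itv/= => /andP[ku uk].
rewrite ceil_le_int in lk; have kb : k + 1 <= Num.floor (n%:R * b) by lia.
rewrite floor_ge_int in kb.
apply/andP; split.
  by apply: le_trans ku; rewrite ler_pdivlMr// mulrC.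
by apply: (le_trans uk); rewrite ler_pdivrMr// mulrC.
Qed.

(** The integer part of n x is a node, except near the ends of [a, b] where the
    first or the last node takes its place. *)
Lemma near_node x : a <= x <= b ->
  exists2 k, k \in node_seq & -1 <= n%:R * x - k%:~R <= 2.
Proof.
move=> /andP[ax xb]; pose q := Num.floor (n%:R * x).
have /andP[q1 q2] : q%:~R <= n%:R * x < (q + 1)%:~R by rewrite /q floor_itv.
rewrite intrD in q2.
have qb : q <= Num.floor (n%:R * b) by rewrite le_floor// ler_pM2l.
have mem k : Num.ceil (n%:R * a) <= k <= Num.floor (n%:R * b) - 1 ->
    k \in node_seq.
  by rewrite mem_node_seq.
have adm' := adm; rewrite /admissible in adm'.
have [qa|aq] := ltP q (Num.ceil (n%:R * a)).
  exists (Num.ceil (n%:R * a)); first by apply: mem; rewrite lexx.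
  have /andP[] : (Num.ceil (n%:R * a) - 1)%:~R < n%:R * a <= (Num.ceil (n%:R * a))%:~R.
    by rewrite ceil_itv.
  rewrite intrB.
  have : n%:R * a <= n%:R * x by rewrite ler_pM2l.
  have : (q + 1)%:~R <= (Num.ceil (n%:R * a))%:~R :> R by rewrite ler_int; lia.
  by rewrite intrD => *; apply/andP; split; lra.
have [qb'|bq] := leP q (Num.floor (n%:R * b) - 1).
  by exists q; [apply: mem; rewrite aq|apply/andP; split; lra].
exists (Num.floor (n%:R * b) - 1); first by apply: mem; rewrite adm' lexx.
have -> : Num.floor (n%:R * b) - 1 = q - 1 by lia.
by rewrite intrB; apply/andP; split; lra.
Qed.

(** The term of a node near n x suffices, as all terms are nonnegative. *)
Lemma density_sum_lower_bound (sigma : R -> R) x : sigmoidal sigma -> a <= x <= b ->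
  density_gap sigma <= \sum_(k <- node_seq) density sigma (n%:R * x - k%:~R).
Proof.
move=> sigmaP /near_node[k kr kx].
rewrite (bigD1_seq k)//= ?node_seq_uniq//; apply: ler_wpDr; last exact: density_lower_bound.
by apply: sumr_ge0 => i _; exact: density_ge0.
Qed.

End nodes_theory.

(** The supporting line at 1 has a positive slope s and gives v <= phi v / s + 1:
    on a set of finite measure, integrability of phi (l |G|) implies that of G. *)
Lemma orlicz_integrable (R : realType) (phi : R -> R) (l : R) (D : set R) (G : R -> R) :
  phi_function phi -> convex_phi phi -> 0 < l -> measurable D ->
  (@lebesgue_measure R D < +oo)%E -> measurable_fun setT G ->
  (\int[@lebesgue_measure R]_(x in D) (phi `|l * G x|)%:E < +oo)%E ->
  (@lebesgue_measure R).-integrable D (EFin \o G).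
Proof.
move=> phiP phi_cvx l0 mD Doo mG fin.
have [s _ sP] := supporting_line phiP phi_cvx ler01.
have s0 : 0 < s.
  have := sP 0 (lexx _); have := phi_gt0 phiP ltr01.
  by rewrite (phi_0 phiP); lra.
have iphi : (@lebesgue_measure R).-integrable D (EFin \o (fun x => phi `|l * G x|)).
  apply/integrableP; split.
    apply/measurable_EFinP; apply: measurable_funTS.
    apply: (measurableT_comp (measurable_phi_norm phiP)).
    exact: measurable_funM.
  under eq_integral do rewrite /= ger0_norm ?(phi_ge0 phiP)//.
  exact: fin.
have ic : (@lebesgue_measure R).-integrable D (EFin \o cst l^-1).
  exact: integrable_cst_lty.
have iZ := @integrableZl _ (measurableTypeR R) _ (@lebesgue_measure R) _ mD (s * l)^-1 _ iphi.
have iD := @integrableD _ (measurableTypeR R) _ (@lebesgue_measure R) _ mD _ _ iZ ic.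
apply: (@le_integrable _ (measurableTypeR R) _ (@lebesgue_measure R) _ mD _ _ _ _ iD).
  by apply/measurable_EFinP; apply: measurable_funTS.
move=> x _ /=; rewrite lee_fin.
have := sP `|l * G x| (normr_ge0 _); have := phi_gt0 phiP ltr01.
rewrite normrM (gtr0_norm l0) => p1 H.
rewrite [leRHS]ger0_norm; last first.
  rewrite addr_ge0 ?invr_ge0 ?(ltW l0)// mulr_ge0 ?invr_ge0 ?mulr_ge0 ?(ltW s0) ?(ltW l0)//.
  by rewrite (phi_ge0 phiP)// mulr_ge0// ltW.
rewrite -(ler_pM2l (mulr_gt0 s0 l0)) mulrDr mulrA divff ?gt_eqF ?mulr_gt0// mul1r.
by rewrite mulfK ?gt_eqF//; lra.
Qed.

(** * The estimate for Lebesgue measurable functions *)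

Section transfer.
Context {R : realType}.
Local Notation mu := (@lebesgue_measure R).
Variables (sigma phi : R -> R) (C : R).
Hypotheses (sigmaP : sigmoidal sigma) (phiP : phi_function phi)
  (phi_cvx : convex_phi phi) (C0 : 0 < C)
  (phiC : forall u v, 0 <= u -> 1 <= v -> phi (u * v) <= C * phi u * phi v).
Variables (a b : R) (f : R -> R) (n : nat) (u c : R).
Hypotheses (ab : a < b) (f_orlicz : orlicz a b phi f) (n0 : (0 < n)%N)
  (adm : admissible a b n) (u0 : 0 < u) (c1 : 1 <= c)
  (modulus_lt : (modulus a b phi f n%:R^-1 < u%:E)%E).

(** Any u above the modulus of smoothness bounds the modulars of all
    short increments of f / u by 1, so the Borel estimate applies to the scaled
    representative; the factor c comes out by convexity. *)
Lemma modular_kantorovich_le :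
  (c%:E * modular a b phi (fun x => (kantorovich a b sigma n f x - f x) / (c * u))%R <=
    (2 * C / density_gap sigma)%:E *
    \sum_(0 <= m <oo) (bandwidth sigma m * phi m.+1%:R)%:E)%E.
Proof.
have T0 : 0 < b - a by rewrite subr_gt0.
have bE : a + (b - a) = b by rewrite addrC subrK.
have [mf [l l0 f_fin]] := f_orlicz.
have mI : measurable (`[a, b]%classic : set R) by exact: measurable_itv.
have [g [N [mg mN N0 fg]]] := borel_representative mI mf.
pose G := periodization a b g.
have mG : measurable_fun setT G by exact: measurable_periodization.
have G_per (k : int) x : G (x + k%:~R * (b - a)) = G x by exact: periodization_periodic.
pose Z := N `|` [set b].
have mZ : measurable Z by apply: measurableU.
have Z0 : mu Z = 0%E.
  by apply: null_set_setU => //; exact: lebesgue_measure_set1.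
have fG x : `[a, b]%classic x -> ~ Z x -> f x = G x.
  rewrite /= in_itv/= => /andP[ax xb] /not_orP[Nx xNb].
  by apply: (eq_periodization ab fg) => //; rewrite ax lt_neqAle xb andbT; exact/eqP.
have mphi (H : R -> R) : measurable_fun setT H ->
    measurable_fun setT (fun x => (phi `|H x|)%:E).
  move=> mH; apply/measurable_EFinP.
  exact: (measurableT_comp (measurable_phi_norm phiP)).
have G_int : mu.-integrable `[a, b]%classic (EFin \o G).
  apply: (orlicz_integrable phiP phi_cvx l0) => //.
    by rewrite lebesgue_measure_itv/=; case: ifPn; rewrite ?ltry// -EFinB ltry.
  rewrite -(integral_completed_ae (Z := Z) (F := fun x => (phi `|l * f x|)%:E))//.
    by apply: mphi; exact: measurable_funM.
  by move=> x abx Zx; rewrite fG.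
pose r := node_seq a b n.
have cell_ab k : k \in r -> (cell n k : set R) `<=` `[a, b]%classic.
  exact: cell_nodes.
have G_cell k : k \in r -> mu.-integrable (cell n k) (EFin \o G).
  move=> kr; apply: integrableS G_int => //; [exact: measurable_itv|exact: cell_ab].
have meanE k : k \in r -> mean n f k = n%:R * \int[mu]_(v in cell n k) G v.
  move=> kr; rewrite /mean /Rintegral; congr (_ * fine _).
  apply: (integral_completed_ae (Z := Z)) => //.
  - exact/measurable_EFinP.
  - by move=> x kx Zx; congr EFin; apply: fG => //; exact: (cell_ab k kr).
pose G' x := u^-1 * G x.
have mG' : measurable_fun setT G' by exact: measurable_funM.
pose K' (x : R) := (\sum_(k <- r) n%:R * (\int[mu]_(v in cell n k) G' v) *
    density sigma (n%:R * x - k%:~R)) /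
  \sum_(k <- r) density sigma (n%:R * x - k%:~R).
have K'E x : K' x = kantorovich a b sigma n f x / u.
  rewrite /K' /kantorovich !fsum_nodes// mulrAC; congr (_ / _).
  rewrite mulr_suml; apply: eq_big_seq => k kr; rewrite meanE//.
  rewrite RintegralZl//; [ring|exact: measurable_itv|exact: G_cell].
have small_shift h : `|h| <= n%:R^-1 ->
    (\int[mu]_(x in `[a, (a + (b - a))%R]) (phi `|G' (x + h) - G' x|)%:E <= 1%:E)%E.
  move=> hn; rewrite bE.
  pose df x := periodization a b f (x + h) - periodization a b f x.
  have : (luxemburg a b phi df < u%:E)%E.
    by apply: le_lt_trans modulus_lt; apply: ereal_sup_ubound; exists h.
  move=> /ereal_inf_lt[_ [w [/= w0 dfw] <-]]; rewrite lte_fin => wu.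
  apply: le_trans dfw.
  pose Zh e := `[a, b]%classic `&` [set x : R | N (fold a b (x + e))].
  have ZhP e : measurable (Zh e) /\ mu (Zh e) = 0%E by exact: fold_null_translate.
  have mGh : measurable_fun setT (fun x : R => G (x + h)).
    by apply: (measurableT_comp mG); exact: measurable_funD.
  have mdG : measurable_fun setT (fun x : R => G' (x + h) - G' x).
    by apply: measurable_funB => //; exact: measurable_funM.
  have mdGw : measurable_fun setT (fun x : R => (G (x + h) - G x) / w).
    by apply: measurable_funM => //; exact: measurable_funB.
  rewrite /modular (@integral_completed_ae _ _ (Zh h `|` Zh 0) _
    (fun x => (phi `|(G (x + h) - G x) / w|)%:E))//.
  - apply: ge0_le_integral => //.
    + by move=> x _; rewrite lee_fin (phi_ge0 phiP).
    + by apply: measurable_funTS; apply: mphi; exact: mdG.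
    + by apply: measurable_funTS; apply: mphi; exact: mdGw.
    move=> x _; rewrite lee_fin (phi_le phiP)// /G' -mulrBr !normrM mulrC.
    by rewrite ler_wpM2l// !gtr0_norm ?invr_gt0// lef_pV2// ltW.
  - exact: mphi.
  - by apply: measurableU; apply: (ZhP _).1.
  - have [[mh h_0] [m0 z_0]] := (ZhP h, ZhP 0); exact: null_set_setU.
  - move=> x abx /not_orP[nh n0x].
    rewrite /df (periodizationE ab fg (x := x + h)); last by move=> Nh; apply: nh.
    by rewrite (periodizationE ab fg (x := x))// => Nx; apply: n0x; split; rewrite //= addr0.
have mK'G' : measurable_fun setT (fun x => K' x - G' x).
  apply: measurable_funB => //.
  exact: (measurable_node_average n r (fun k => n%:R * \int[mu]_(v in cell n k) G' v) sigmaP).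
have G'_per (k : int) x : G' (x + k%:~R * (b - a)) = G' x by rewrite /G' G_per.
have G'_int k : k \in r -> mu.-integrable (cell n k) (EFin \o G').
  move=> kr.
  exact: (@integrableZl _ (measurableTypeR R) _ mu _ (measurable_itv _) u^-1 _ (G_cell k kr)).
have r_dense x : a <= x <= a + (b - a) ->
    density_gap sigma <= \sum_(k <- r) density sigma (n%:R * x - k%:~R).
  by rewrite bE => abx; exact: density_sum_lower_bound.
have c0 : 0 < c by exact: lt_le_trans c1.
have mK'G'c : measurable_fun setT (fun x => (K' x - G' x) / c).
  exact: measurable_funM.
rewrite /modular (@integral_completed_ae _ _ Z _ (fun x => (phi `|(K' x - G' x) / c|)%:E))//.
- rewrite -ge0_integralZl_EFin ?(ltW c0)//; last 2 first.
  + by move=> x _; rewrite lee_fin (phi_ge0 phiP).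
  + by apply: measurable_funTS; exact: mphi.
  have := borel_estimate sigmaP phiP phi_cvx C0 phiC T0 mG' G'_per n0
    (node_seq_uniq a b n) ler01 small_shift G'_int r_dense.
  rewrite bE mulr1; apply: le_trans; apply: ge0_le_integral => //.
  + by move=> x _; rewrite mule_ge0 ?lee_fin ?(ltW c0) ?(phi_ge0 phiP).
  + by apply: measurable_funTS; apply: measurable_funeM; exact: mphi.
  + by apply: measurable_funTS; exact: mphi.
  move=> x _; rewrite -EFinM lee_fin normrM normfV (gtr0_norm c0).
  exact: (phi_contract phiP phi_cvx).
- exact: mphi.
- move=> x abx Zx; rewrite K'E /G' fG//; congr (phi `|_|)%:E.
  by field; rewrite !gt_eqF.
Qed.

End transfer.

(** * The theorem *)

Theorem theorem5p5 (R : realType) (sigma phi : R -> R) (beta : R) :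
  sigmoidal sigma ->
  phi_function phi ->
  convex_phi phi ->
  Delta'_condition phi ->
  1 < beta ->
  (forall u v : R, 0 < u -> u <= v ->
     u `^ (- beta) * phi u <= v `^ (- beta) * phi v) ->
  (moment phi 0 1 (density sigma) < +oo)%E ->
  exists2 Psi : R, 0 < Psi &
    forall a b : R, a < b ->
    forall f : R -> R, orlicz a b phi f ->
    \forall n \near \oo, admissible a b n ->
      (luxemburg a b phi (fun x => kantorovich a b sigma n f x - f x)%R
         <= Psi%:E * modulus a b phi f n%:R^-1%R)%E.
Proof.
move=> sigmaP phiP phi_cvx Delta _ _ moo.
have [C C0 phiC] := Delta.
set series := (\sum_(0 <= m <oo) (bandwidth sigma m * phi m.+1%:R)%:E)%E.
have series_ge0 : (0 <= series)%E.
  by apply: nneseries_ge0 => m _ _; rewrite lee_fin mulr_ge0 ?bandwidth_ge0 ?(phi_ge0 phiP).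
have series_fin : series \is a fin_num.
  by rewrite ge0_fin_numE//; exact: bandwidth_summable.
pose D := 2 * C / density_gap sigma * fine series.
pose Psi := Num.max 1 D.
have Psi1 : 1 <= Psi by rewrite le_max lexx.
have DPsi : D <= Psi by rewrite le_max lexx orbT.
have Psi0 : 0 < Psi by exact: lt_le_trans Psi1.
exists Psi => // a b ab f f_orlicz; near=> n => adm.
have n0 : (0 < n)%N by near: n; exact: nbhs_infty_gt.
set w := modulus _ _ _ _ _.
have w_ge0 : (0 <= w)%E.
  apply: (@le_trans _ _ (luxemburg a b phi
      (fun x => periodization a b f (x + 0) - periodization a b f x)%R)).
    by apply: le_ereal_inf_tmp => _ [u [/= u0 _] <-]; rewrite lee_fin ltW.
  by apply: ereal_sup_ubound; exists 0 => //=; rewrite normr0 invr_ge0.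
have [->|w_fin] := eqVneq w +oo%E; first by rewrite gt0_muley ?lte_fin// leey.
have wE : w = (fine w)%:E by rewrite fineK// ge0_fin_numE// ltey.
have lux_le u : fine w < u ->
    (luxemburg a b phi (fun x => kantorovich a b sigma n f x - f x)%R <= (Psi * u)%:E)%E.
  move=> wu; have u0 : 0 < u by apply: le_lt_trans wu; rewrite fine_ge0.
  apply: ereal_inf_lbound; exists (Psi * u) => //=; split; first exact: mulr_gt0.
  have := modular_kantorovich_le sigmaP phiP phi_cvx C0 phiC ab f_orlicz n0 adm u0 Psi1.
  rewrite -/w wE lte_fin => /(_ wu); rewrite -/series -(fineK series_fin) -EFinM -/D.
  move=> H; rewrite -(lee_pmul2l (x := Psi%:E))// ?lte_fin// mule1.
  by apply: (le_trans H); rewrite lee_fin.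
apply/lee_addgt0Pr => e e0.
apply: (le_trans (lux_le (fine w + e / Psi) _)).
  by rewrite ltrDl divr_gt0.
rewrite [X in (_ <= _ * X + _)%E]wE -EFinM -EFinD lee_fin mulrDr.
rewrite le_eqVlt; apply/orP; left; apply/eqP.
by field; rewrite gt_eqF.
Unshelve. all: by end_near.
Qed.
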